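(* Let $R \supseteq \mathsf{ZFC}$ be a theory in the signature $\{\in\}$, and let $A \subseteq \mathrm{Form}_{\in}\times 2$ be such that $R+T_{\in,A}$ has an absolute model companion in the signature $\in_A$ (i.e. $A$ belongs to the AMC-spectrum of $R$), and such that $\in_A$ contains $\in_{\Delta_0}$. Suppose that the theory $\neg\mathsf{CH} + (R+T_{\in,A})^{\in_A}_{\forall\vee\exists}$ is consistent. Then $\mathsf{CH}$ is not a member of the absolute model companion $\mathsf{AMC}(R,A)$ of $R+T_{\in,A}$.
   Context: All theories are first order. For a signature $\tau$ and a $\tau$-theory $T$, $T^\tau_{\forall\vee\exists}$ denotes the set of boolean combinations of universal $\tau$-sentences that are consequences of $T$. A $\tau$-theory $T$ is model complete if every embedding between models of $T$ is elementary. A $\tau$-theory $S$ is the absolute model companion (AMC) of a $\tau$-theory $T$ if $S$ is model complete and $S^\tau_{\forall\vee\exists}=T^\tau_{\forall\vee\exists}$. Partial Morleyization: $\mathrm{Form}_\in$ is the set of $\{\in\}$-formulae. For each formula $\phi(x_0,\dots,x_n)$ let $R_\phi$ be a new $(n+1)$-ary relation symbol, $f_\phi$ a new $n$-ary function symbol, and $c$ a new constant symbol. Let $\mathrm{Ax}^0_\phi$ be $\forall\vec x\,[\phi(\vec x)\leftrightarrow R_\phi(\vec x)]$, and $\mathrm{Ax}^1_\phi$ be $\forall x_1,\dots,x_n\,[(\exists! y\,\phi(y,x_1,\dots,x_n)\to\phi(f_\phi(x_1,\dots,x_n),x_1,\dots,x_n))\wedge(\neg\exists!y\,\phi(y,x_1,\dots,x_n)\to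 f_\phi(x_1,\dots,x_n)=c)]$ (with the evident modification when $n=0$, $f_\phi$ then being a constant). For $A\subseteq \mathrm{Form}_\in\times 2$, $\in_A$ is the signature obtained from $\{\in\}$ by adding $R_\phi$ for $(\phi,0)\in A$, $f_\phi$ for $(\phi,1)\in A$, and $c$; $T_{\in,A}$ is the $\in_A$-theory with axioms $\mathrm{Ax}^i_\phi$ for $(\phi,i)\in A$ together with $\forall x\,[(\forall y\, y\notin x)\leftrightarrow c=x]$. $A$ is in the AMC-spectrum of $R$ if $R+T_{\in,A}$ has an AMC in signature $\in_A$, denoted $\mathsf{AMC}(R,A)$. $\in_{\Delta_0}$ denotes the signature extending $\{\in\}$ by relation symbols $R_\phi$ for all $\Delta_0$-formulae $\phi$ (formulae all of whose quantifiers are bounded), a constant symbol for $\omega$, and function symbols for the Gödel operations, interpreted by the corresponding defining axioms; ''$\in_A$ contains $\in_{\Delta_0}$'' means these symbols occur in $\in_A$ with these interpretations enforced by $T_{\in,A}$. $\mathsf{CH}$ is the sentence asserting that the first uncountable cardinal $\aleph_1$ exists and there is a function with domain $\aleph_1$ whose range contains every subset of $\omega$; $\neg\mathsf{CH}$ is the sentence asserting that $\aleph_1$ exists and no function with domain $\aleph_1$ has range containing every subset of $\omega$ (both regarded as $\in_A$-sentences). *)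

(* Defs.v *)
From mathcomp Require Import all_boot.
From mathcomp Require Import boolp classical_sets.

Set Implicit Arguments.
Unset Strict Implicit.
Unset Printing Implicit Defensive.

Local Open Scope classical_set_scope.

(* Variables are de Bruijn indices: a [formula L n] has its free variables  *)
(* among x_0, ..., x_(n-1); a quantifier binds index 0 of a formula in      *)
(* n+1 variables and renumbers the old variable x_i as x_(i+1).             *)

Record signature := Signature {
  rel_sym : Type; rel_ar : rel_sym -> nat;
  fct_sym : Type; fct_ar : fct_sym -> nat }.

Inductive term (L : signature) (n : nat) : Type :=
| tVar of 'I_n
| tApp (f : fct_sym L) of ('I_(fct_ar f) -> term L n).

Arguments tVar {L n}.
Arguments tApp {L n}.

Inductive formula (L : signature) (n : nat) : Type :=
| fEq of term L n & term L n
| fRel (r : rel_sym L) of ('I_(rel_ar r) -> term L n)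
| fBot
| fAnd of formula L n & formula L n
| fOr of formula L n & formula L n
| fImp of formula L n & formula L n
| fAll of formula L n.+1
| fEx of formula L n.+1.

Arguments fEq {L n}.
Arguments fRel {L n}.
Arguments fBot {L n}.
Arguments fAnd {L n}.
Arguments fOr {L n}.
Arguments fImp {L n}.
Arguments fAll {L n}.
Arguments fEx {L n}.

Notation fNot a := (fImp a fBot).
Notation fIff a b := (fAnd (fImp a b) (fImp b a)).

Notation sentence L := (formula L 0).
Notation theory L := (set (sentence L)).

Definition scons {T : Type} {n : nat} (x : T) (e : 'I_n -> T) :
    'I_n.+1 -> T :=
  fun i => oapp e x (unlift ord0 i).

Notation sh x := (lift ord0 x).

Section Syntax.
Context {L : signature}.

Fixpoint tsubst n m (s : 'I_n -> term L m) (t : term L n) : term L m :=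
  match t with
  | tVar i => s i
  | tApp f a => tApp f (fun j => tsubst s (a j))
  end.

Definition up n m (s : 'I_n -> term L m) : 'I_n.+1 -> term L m.+1 :=
  scons (tVar ord0) (fun i => tsubst (fun j => tVar (sh j)) (s i)).

Fixpoint subst n m (s : 'I_n -> term L m) (phi : formula L n) : formula L m :=
  match phi with
  | fEq t u => fEq (tsubst s t) (tsubst s u)
  | fRel r a => fRel r (fun j => tsubst s (a j))
  | fBot => fBot
  | fAnd p q => fAnd (subst s p) (subst s q)
  | fOr p q => fOr (subst s p) (subst s q)
  | fImp p q => fImp (subst s p) (subst s q)
  | fAll p => fAll (subst (up s) p)
  | fEx p => fEx (subst (up s) p)
  end.

Definition rename n m (r : 'I_n -> 'I_m) : formula L n -> formula L m :=
  subst (fun i => tVar (r i)).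

Fixpoint univ_closure n : formula L n -> sentence L :=
  match n with
  | 0 => fun phi => phi
  | n'.+1 => fun phi => univ_closure (fAll phi)
  end.

Fixpoint quantifier_free n (phi : formula L n) : bool :=
  match phi with
  | fEq _ _ | fRel _ _ | fBot => true
  | fAnd p q | fOr p q | fImp p q => quantifier_free p && quantifier_free q
  | fAll _ | fEx _ => false
  end.

Fixpoint universal n (phi : formula L n) : bool :=
  match phi with
  | fAll p => universal p
  | _ => quantifier_free phi
  end.

Fixpoint bool_comb_universal n (phi : formula L n) : bool :=
  universal phi ||
  match phi with
  | fAnd p q | fOr p q | fImp p q =>
      bool_comb_universal p && bool_comb_universal q
  | _ => false
  end.

End Syntax.

Record structure (L : signature) := Structure {
  carrier :> Type;
  carrier_inhabited : inhabited carrier;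
  rel_of : forall r : rel_sym L, ('I_(rel_ar r) -> carrier) -> Prop;
  fct_of : forall f : fct_sym L, ('I_(fct_ar f) -> carrier) -> carrier }.

Section Semantics.
Context {L : signature}.

Fixpoint eval (M : structure L) n (e : 'I_n -> M) (t : term L n) : M :=
  match t with
  | tVar i => e i
  | tApp f a => fct_of (fun j => eval e (a j))
  end.

Fixpoint sat (M : structure L) n (e : 'I_n -> M) (phi : formula L n) : Prop :=
  match phi with
  | fEq t u => eval e t = eval e u
  | fRel r a => rel_of (fun j => eval e (a j))
  | fBot => False
  | fAnd p q => sat e p /\ sat e q
  | fOr p q => sat e p \/ sat e q
  | fImp p q => sat e p -> sat e q
  | fAll p => forall x : M, sat (scons x e) p
  | fEx p => exists x : M, sat (scons x e) p
  end.

Definition holds (M : structure L) (phi : sentence L) : Prop :=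
  forall e : 'I_0 -> M, sat e phi.

Definition model_of (T : theory L) (M : structure L) : Prop :=
  forall phi, T phi -> holds M phi.

Definition entails (T : theory L) (phi : sentence L) : Prop :=
  forall M : structure L, model_of T M -> holds M phi.

(* By the completeness theorem, equivalent to not deriving a contradiction. *)
Definition consistent (T : theory L) : Prop :=
  exists M : structure L, model_of T M.

Record embedding (M N : structure L) (h : M -> N) : Prop := {
  embedding_inj : injective h;
  embedding_rel : forall (r : rel_sym L) (a : 'I_(rel_ar r) -> M),
    rel_of (fun j => h (a j)) <-> rel_of a;
  embedding_fct : forall (f : fct_sym L) (a : 'I_(fct_ar f) -> M),
    h (fct_of a) = fct_of (fun j => h (a j)) }.

Definition elementary (M N : structure L) (h : M -> N) : Prop :=
  forall n (phi : formula L n) (e : 'I_n -> M),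
    sat e phi <-> sat (fun i => h (e i)) phi.

Definition model_complete (T : theory L) : Prop :=
  forall (M N : structure L) (h : M -> N),
    model_of T M -> model_of T N -> embedding h -> elementary h.

Definition forall_or_exists_part (T : theory L) : theory L :=
  [set phi | bool_comb_universal phi /\ entails T phi].

Definition is_AMC (S T : theory L) : Prop :=
  model_complete S /\ forall_or_exists_part S = forall_or_exists_part T.

End Semantics.

Definition sig_in : signature :=
  @Signature unit (fun _ => 2) void (fun f : void => match f with end).

Notation form n := (formula sig_in n).

Definition mem_fm n (x y : 'I_n) : form n :=
  @fRel sig_in n tt (tnth [tuple tVar x; tVar y]).
Definition eq_fm n (x y : 'I_n) : form n := fEq (tVar x) (tVar y).

Definition ball n (x : 'I_n) (phi : form n.+1) : form n :=
  fAll (fImp (mem_fm ord0 (sh x)) phi).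
Definition bex n (x : 'I_n) (phi : form n.+1) : form n :=
  fEx (fAnd (mem_fm ord0 (sh x)) phi).

Inductive Delta0 (n : nat) : form n -> Prop :=
| Delta0_Eq t u : Delta0 (fEq t u)
| Delta0_Rel r a : Delta0 (fRel r a)
| Delta0_Bot : Delta0 fBot
| Delta0_And p q : Delta0 p -> Delta0 q -> Delta0 (fAnd p q)
| Delta0_Or p q : Delta0 p -> Delta0 q -> Delta0 (fOr p q)
| Delta0_Imp p q : Delta0 p -> Delta0 q -> Delta0 (fImp p q)
| Delta0_ball x p : @Delta0 n.+1 p -> Delta0 (ball x p)
| Delta0_bex x p : @Delta0 n.+1 p -> Delta0 (bex x p).

Notation v0 := ord0.
Notation v1 := (sh v0).
Notation v2 := (sh v1).
Notation v3 := (sh v2).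

Definition is_empty n (x : 'I_n) : form n := ball x fBot.

Definition subset_fm n (x y : 'I_n) : form n := ball x (mem_fm v0 (sh y)).

(* Under Foundation, the von Neumann ordinals are the transitive sets       *)
(* linearly ordered by membership.                                          *)
Definition ordinal_fm n (x : 'I_n) : form n :=
  fAnd (ball x (subset_fm v0 (sh x)))
       (ball x (ball (sh x)
         (fOr (mem_fm v1 v0) (fOr (eq_fm v1 v0) (mem_fm v0 v1))))).

Definition limit_fm n (x : 'I_n) : form n :=
  fAnd (ordinal_fm x)
  (fAnd (fNot (is_empty x)) (ball x (bex (sh x) (mem_fm v1 v0)))).

Definition is_omega n (x : 'I_n) : form n :=
  fAnd (limit_fm x) (ball x (fNot (limit_fm v0))).

(* z = {u, v} *)
Definition upair n (z u v : 'I_n) : form n :=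
  fAnd (mem_fm u z)
  (fAnd (mem_fm v z) (ball z (fOr (eq_fm v0 (sh u)) (eq_fm v0 (sh v))))).

(* p = (u, v) = {{u}, {u, v}} *)
Definition opair n (p u v : 'I_n) : form n :=
  bex p (bex (sh p)
    (fAnd (upair v1 (sh (sh u)) (sh (sh u)))
    (fAnd (upair v0 (sh (sh u)) (sh (sh v)))
          (upair (sh (sh p)) v1 v0)))).

(* p is an ordered pair with first coordinate u *)
Definition has_fst n (p u : 'I_n) : form n :=
  bex p (bex v0 (opair (sh (sh p)) (sh (sh u)) v0)).

(* p is an ordered pair with second coordinate v *)
Definition has_snd n (p v : 'I_n) : form n :=
  bex p (bex v0 (opair (sh (sh p)) v0 (sh (sh v)))).

(* (u, v) \in f *)
Definition app_fm n (f u v : 'I_n) : form n := bex f (opair v0 (sh u) (sh v)).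

Definition in_range n (v f : 'I_n) : form n := bex f (has_snd v0 (sh v)).

(* f is a function with domain x *)
Definition fun_dom n (f x : 'I_n) : form n :=
  fAnd (ball f (bex (sh x) (has_fst v1 v0)))
  (fAnd (ball x (bex (sh f) (has_fst v0 v1)))
        (ball x (ball (sh f) (ball (sh (sh f))
          (fImp (has_fst v1 v2) (fImp (has_fst v0 v2) (eq_fm v1 v0))))))).

(* g is an injection from x into y *)
Definition injection_fm n (g x y : 'I_n) : form n :=
  fAnd (fun_dom g x)
  (fAnd (ball x (bex (sh y) (app_fm (sh (sh g)) v1 v0)))
        (ball x (ball (sh x) (ball (sh (sh y))
          (fImp (app_fm (sh (sh (sh g))) v2 v0)
          (fImp (app_fm (sh (sh (sh g))) v1 v0) (eq_fm v2 v1))))))).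

(* g is a bijection from x onto y *)
Definition bijection_fm n (g x y : 'I_n) : form n :=
  fAnd (injection_fm g x y) (ball y (in_range v0 (sh g))).

Lemma Delta0_subset n (x y : 'I_n) : Delta0 (subset_fm x y).
Proof. by do !constructor. Qed.

Lemma Delta0_ordinal n (x : 'I_n) : Delta0 (ordinal_fm x).
Proof. by do !constructor. Qed.

Lemma Delta0_opair n (p u v : 'I_n) : Delta0 (opair p u v).
Proof. by do !constructor. Qed.

Lemma Delta0_has_fst n (p u : 'I_n) : Delta0 (has_fst p u).
Proof. by do 2!constructor; exact: Delta0_opair. Qed.

Lemma Delta0_has_snd n (p v : 'I_n) : Delta0 (has_snd p v).
Proof. by do 2!constructor; exact: Delta0_opair. Qed.

Lemma Delta0_app n (f u v : 'I_n) : Delta0 (app_fm f u v).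
Proof. by constructor; exact: Delta0_opair. Qed.

Lemma Delta0_in_range n (v f : 'I_n) : Delta0 (in_range v f).
Proof. by constructor; exact: Delta0_has_snd. Qed.

Lemma Delta0_fun_dom n (f x : 'I_n) : Delta0 (fun_dom f x).
Proof. by do !constructor; exact: Delta0_opair. Qed.

Lemma Delta0_injection n (g x y : 'I_n) : Delta0 (injection_fm g x y).
Proof.
by constructor; [exact: Delta0_fun_dom | do !constructor; exact: Delta0_app].
Qed.

Lemma Delta0_bijection n (g x y : 'I_n) : Delta0 (bijection_fm g x y).
Proof.
by constructor; [exact: Delta0_injection | constructor; exact: Delta0_in_range].
Qed.

Definition ax_extensionality : sentence sig_in :=
  fAll (fAll (fImp (fAll (fIff (mem_fm v0 v2) (mem_fm v0 v1))) (eq_fm v1 v0))).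

Definition ax_foundation : sentence sig_in :=
  fAll (fImp (fEx (mem_fm v0 v1)) (bex v0 (ball v1 (fNot (mem_fm v0 v1))))).

Definition ax_pairing : sentence sig_in :=
  fAll (fAll (fEx (fAll
    (fIff (mem_fm v0 v1) (fOr (eq_fm v0 v3) (eq_fm v0 v2)))))).

Definition ax_union : sentence sig_in :=
  fAll (fEx (fAll (fIff (mem_fm v0 v1) (bex v2 (mem_fm v1 v0))))).

Definition ax_powerset : sentence sig_in :=
  fAll (fEx (fAll (fIff (mem_fm v0 v1) (subset_fm v0 v2)))).

(* There is a set containing the empty set and closed under y |-> y U {y}.  *)
Definition ax_infinity : sentence sig_in :=
  fEx (fAnd (bex v0 (is_empty v0))
    (ball v0 (bex v1 (fAll
      (fIff (mem_fm v0 v1) (fOr (mem_fm v0 v2) (eq_fm v0 v2))))))).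

(* Every set of nonempty sets has a choice function. *)
Definition ax_choice : sentence sig_in :=
  fAll (fImp (ball v0 (fNot (is_empty v0)))
    (fEx (fAnd (fun_dom v0 v1) (ball v1 (bex v0 (app_fm v2 v1 v0)))))).

(* phi(z, p_1, ..., p_n); the parameters p_i are universally closed. *)
Definition ax_separation n (phi : form n.+1) : sentence sig_in :=
  univ_closure (fAll (fEx (fAll
    (fIff (mem_fm v0 v1)
      (fAnd (mem_fm v0 v2)
            (rename (scons v0 (fun i => sh (sh (sh i)))) phi)))))).

(* phi(x, y, p_1, ..., p_n): if phi is functional in x, then every set has  *)
(* an image under it.                                                       *)
Definition ax_replacement n (phi : form n.+2) : sentence sig_in :=
  univ_closure (fImp
    (fAll (fAll (fAll
      (fImp (rename (scons v2 (scons v1 (fun i => sh (sh (sh i))))) phi)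
      (fImp (rename (scons v2 (scons v0 (fun i => sh (sh (sh i))))) phi)
            (eq_fm v1 v0))))))
    (fAll (fEx (fAll
      (fIff (mem_fm v0 v1)
        (bex v2 (rename (scons v0 (scons v1
           (fun i => sh (sh (sh (sh i)))))) phi))))))).

Inductive ZFC : theory sig_in :=
| ZFC_extensionality : ZFC ax_extensionality
| ZFC_foundation : ZFC ax_foundation
| ZFC_pairing : ZFC ax_pairing
| ZFC_union : ZFC ax_union
| ZFC_powerset : ZFC ax_powerset
| ZFC_infinity : ZFC ax_infinity
| ZFC_choice : ZFC ax_choice
| ZFC_separation n (phi : form n.+1) : ZFC (ax_separation phi)
| ZFC_replacement n (phi : form n.+2) : ZFC (ax_replacement phi).

(* A formula phi(x_0, ..., x_n) of set theory, with its number n. *)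
Record Form_in := FormIn { fi_n : nat; fi_phi : form fi_n.+1 }.
Arguments FormIn : clear implicits.
Arguments FormIn {fi_n}.

(* Form_in x 2 : the index 0 is [false] (add the relation symbol R_phi),    *)
(* the index 1 is [true] (add the function symbol f_phi).                   *)
Notation morley_set := (set (Form_in * bool)).

Inductive rel_A (A : morley_set) : Type :=
| rMem
| rPhi (phi : Form_in) of A (phi, false).
Arguments rMem {A}.

Inductive fct_A (A : morley_set) : Type :=
| fC
| fPhi (phi : Form_in) of A (phi, true).
Arguments fC {A}.

Definition sig_A (A : morley_set) : signature :=
  @Signature
    (rel_A A)
    (fun r => match r with rMem => 2 | rPhi phi _ => (fi_n phi).+1 end)
    (fct_A A) (fun f => match f with fC => 0 | fPhi phi _ => fi_n phi end).

Section Morleyization.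
Variable A : morley_set.
Notation term_A n := (term (sig_A A) n).
Notation form_A n := (formula (sig_A A) n).

Definition memA n (t u : term_A n) : form_A n :=
  @fRel (sig_A A) n rMem (tnth [tuple t; u]).

Definition cA n : term_A n := @tApp (sig_A A) n fC (ffun0 (card_ord 0)).

Definition relA n (phi : Form_in) (h : A (phi, false))
    (a : 'I_(fi_n phi).+1 -> term_A n) : form_A n :=
  @fRel (sig_A A) n (rPhi h) a.

Definition fctA n (phi : Form_in) (h : A (phi, true))
    (a : 'I_(fi_n phi) -> term_A n) : term_A n :=
  @tApp (sig_A A) n (fPhi h) a.

Definition term_to_A n (t : term sig_in n) : term_A n :=
  match t with
  | tVar i => tVar i
  | tApp f _ => match f with end
  end.

(* An {in}-formula regarded as an in_A-formula. *)
Fixpoint to_A n (phi : form n) : form_A n :=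
  match phi with
  | fEq t u => fEq (term_to_A t) (term_to_A u)
  | fRel _ a => @fRel (sig_A A) n rMem (fun j => term_to_A (a j))
  | fBot => fBot
  | fAnd p q => fAnd (to_A p) (to_A q)
  | fOr p q => fOr (to_A p) (to_A q)
  | fImp p q => fImp (to_A p) (to_A q)
  | fAll p => fAll (to_A p)
  | fEx p => fEx (to_A p)
  end.

Definition Ax0 (phi : Form_in) (h : A (phi, false)) : sentence (sig_A A) :=
  univ_closure (fIff (to_A (fi_phi phi)) (relA h tVar)).

Definition exists_unique n (phi : form_A n.+1) : form_A n :=
  fEx (fAnd phi
    (fAll (fImp (rename (scons v0 (fun i => sh (sh i))) phi)
                (fEq (tVar v0) (tVar v1))))).

Definition Ax1 (phi : Form_in) (h : A (phi, true)) : sentence (sig_A A) :=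
  let psi := to_A (fi_phi phi) in
  univ_closure
    (fAnd (fImp (exists_unique psi) (subst (scons (fctA h tVar) tVar) psi))
          (fImp (fNot (exists_unique psi)) (fEq (fctA h tVar) (cA _)))).

Definition Ax_c : sentence (sig_A A) :=
  fAll (fIff (fAll (fNot (memA (tVar v0) (tVar v1)))) (fEq (cA _) (tVar v0))).

Inductive T_in_A : theory (sig_A A) :=
| T_Ax0 phi (h : A (phi, false)) : T_in_A (Ax0 h)
| T_Ax1 phi (h : A (phi, true)) : T_in_A (Ax1 h)
| T_Ax_c : T_in_A Ax_c.

End Morleyization.

Definition R_plus_T (R : theory sig_in) (A : morley_set) : theory (sig_A A) :=
  [set to_A A phi | phi in R] `|` @T_in_A A.
Arguments R_plus_T : clear implicits.

Definition in_AMC_spectrum (R : theory sig_in) (A : morley_set) : Prop :=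
  exists S, is_AMC S (R_plus_T R A).

(* Any two absolute model companions of a theory are logically equivalent,  *)
(* so this is the unique deductively closed one.                            *)
Definition AMC (R : theory sig_in) (A : morley_set) : theory (sig_A A) :=
  [set phi | exists2 S, is_AMC S (R_plus_T R A) & entails S phi].
Arguments AMC : clear implicits.

(* y = {z | psi(z, x_1, ..., x_n)}, as a formula in y, x_1, ..., x_n. *)
Definition comprehension n (psi : form n.+1) : form n.+1 :=
  fAll (fIff (mem_fm v0 v1) (rename (scons v0 (fun i => sh (sh i))) psi)).

(* t = (u, v, w) = ((u, v), w) *)
Definition otriple n (t u v w : 'I_n) : form n :=
  fEx (fAnd (opair v0 (sh u) (sh v)) (opair (sh t) v0 (sh w))).

(* The ten Godel operations G_1, ..., G_10 of Jech, Set Theory, Def. 13.6.  *)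
Definition godel_ops : seq Form_in := [::
  (* {X, Y} *)
  @FormIn 2 (comprehension (fOr (eq_fm v0 v1) (eq_fm v0 v2)));
  (* X x Y *)
  @FormIn 2 (comprehension (bex v1 (bex v3 (opair v2 v1 v0))));
  (* {(u, v) | u in X, v in Y, u in v} *)
  @FormIn 2 (comprehension
    (bex v1 (bex v3 (fAnd (opair v2 v1 v0) (mem_fm v1 v0)))));
  (* X \ Y *)
  @FormIn 2 (comprehension (fAnd (mem_fm v0 v1) (fNot (mem_fm v0 v2))));
  (* X n Y *)
  @FormIn 2 (comprehension (fAnd (mem_fm v0 v1) (mem_fm v0 v2)));
  (* U X *)
  @FormIn 1 (comprehension (bex v1 (mem_fm v1 v0)));
  (* dom X *)
  @FormIn 1 (comprehension (fEx (app_fm v2 v1 v0)));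
  (* {(u, v) | (v, u) in X} *)
  @FormIn 1 (comprehension
    (fEx (fEx (fAnd (opair v2 v1 v0) (app_fm v3 v0 v1)))));
  (* {(u, v, w) | (u, w, v) in X} *)
  @FormIn 1 (comprehension
    (fEx (fEx (fEx (fAnd (otriple v3 v2 v1 v0)
                         (bex (sh v3) (otriple v0 v3 v1 v2)))))));
  (* {(u, v, w) | (v, w, u) in X} *)
  @FormIn 1 (comprehension
    (fEx (fEx (fEx (fAnd (otriple v3 v2 v1 v0)
                         (bex (sh v3) (otriple v0 v2 v1 v3)))))))].

Definition omega_fm : Form_in := @FormIn 0 (is_omega v0).

Inductive in_Delta0 : morley_set :=
| in_Delta0_rel n (phi : form n.+1) :
    Delta0 phi -> in_Delta0 (FormIn phi, false)
| in_Delta0_omega : in_Delta0 (omega_fm, true)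
| in_Delta0_godel k : k < size godel_ops ->
    in_Delta0 (nth omega_fm godel_ops k, true).

(* CH and its negation as in_A-sentences, when in_A contains in_Delta0: the *)
(* Delta_0 notions are expressed by the corresponding relation symbols      *)
(* and omega by its constant symbol.  Expanding the symbols R_phi gives an  *)
(* equivalent sentence over T_{in,A}, but not over weaker theories such as  *)
(* the consequences of R + T_{in,A} that are boolean combinations of        *)
(* universal sentences.                                                     *)

Section ContinuumHypothesis.
Variable A : morley_set.
Hypothesis hA : in_Delta0 `<=` A.
Notation term_A n := (term (sig_A A) n).
Notation form_A n := (formula (sig_A A) n).

Definition atom n (k : nat) (phi : form k.+1) (d : Delta0 phi)
    (a : k.+1.-tuple (term_A n)) : form_A n :=
  @relA A n (FormIn phi) (hA (in_Delta0_rel d)) (tnth a).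

Definition omegaA n : term_A n :=
  @fctA A n omega_fm (hA in_Delta0_omega) (ffun0 (card_ord 0)).

Definition subsetA n (x y : term_A n) : form_A n :=
  atom (Delta0_subset (v0 : 'I_2) v1) [tuple x; y].

Definition ordinalA n (x : term_A n) : form_A n :=
  atom (Delta0_ordinal (v0 : 'I_1)) [tuple x].

Definition fun_domA n (f x : term_A n) : form_A n :=
  atom (Delta0_fun_dom (v0 : 'I_2) v1) [tuple f; x].

Definition in_rangeA n (r f : term_A n) : form_A n :=
  atom (Delta0_in_range (v0 : 'I_2) v1) [tuple r; f].

Definition injectionA n (g x y : term_A n) : form_A n :=
  atom (Delta0_injection (v0 : 'I_3) v1 v2) [tuple g; x; y].

Definition bijectionA n (g x y : term_A n) : form_A n :=
  atom (Delta0_bijection (v0 : 'I_3) v1 v2) [tuple g; x; y].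

Definition countableA n (x : 'I_n) : form_A n :=
  fEx (injectionA (tVar v0) (tVar (sh x)) (omegaA _)).

(* x is an ordinal not equinumerous with any of its elements *)
Definition cardinalA n (x : 'I_n) : form_A n :=
  fAnd (ordinalA (tVar x))
    (fAll (fImp (memA (tVar v0) (tVar (sh x)))
      (fNot (fEx (bijectionA (tVar v0) (tVar (sh (sh x))) (tVar v1)))))).

Definition first_uncountable_cardinal n (x : 'I_n) : form_A n :=
  fAnd (cardinalA x)
  (fAnd (fNot (countableA x))
        (fAll (fImp (memA (tVar v0) (tVar (sh x)))
          (fImp (cardinalA v0) (countableA v0))))).

(* some function with domain x has every subset of omega in its range *)
Definition enumerates_reals n (x : 'I_n) : form_A n :=
  fEx (fAnd (fun_domA (tVar v0) (tVar (sh x)))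
    (fAll (fImp (subsetA (tVar v0) (omegaA _))
                (in_rangeA (tVar v0) (tVar v1))))).

Definition CH : sentence (sig_A A) :=
  fEx (fAnd (first_uncountable_cardinal v0) (enumerates_reals v0)).

Definition not_CH : sentence (sig_A A) :=
  fEx (fAnd (first_uncountable_cardinal v0) (fNot (enumerates_reals v0))).

End ContinuumHypothesis.

(* Main.v *)
(* Let S be the companion of T = R + T_{in,A} and suppose S |- CH.  Starting from a *)
(* model of not-CH and of the boolean combinations of universal consequences of T,  *)
(* compactness gives embeddings N0 -> M -> P -> N1 -> P1 -> N2 -> P2 with N0, N1, N2 *)
(* models of S, with P, P1, P2 models of T, and M a model of not-CH.  Model         *)
(* completeness makes N0 -> N1 -> N2 elementary, so the first uncountable cardinal x *)
(* and the enumeration f of the reals given by CH in N0 keep these properties in N1 *)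
(* and N2, and f enumerates the reals of M, P and P1.                               *)
(* Since M and the Ni need not satisfy ZFC, x might fail to be aleph_1 of P.  But if *)
(* b = aleph_1 of P were countable in P1, then a real of P1 would code all of the   *)
(* b distinct reals copying the initial segments of b into omega, whereas in P no   *)
(* real in the range of f does; this is Delta_0 and all reals of P1 are in that     *)
(* range.  So b is an uncountable cardinal in N1, whence b = x.  Thus P, hence N1,  *)
(* hence N0, has a sequence e of injections of the elements of x into omega.  The   *)
(* witness y of not-CH in M cannot be x because of f, nor lie above x since x is an *)
(* uncountable cardinal in M; and if y is in x then e(y) lies in M, which is closed *)
(* under the Godel operations, so y is countable in M.                              *)

Require Import Defs.
From Stdlib Require List.
From mathcomp Require Import all_boot.
From mathcomp Require Import boolp classical_sets filter.

Set Implicit Arguments.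
Unset Strict Implicit.
Unset Printing Implicit Defensive.

Local Open Scope classical_set_scope.

(** * Substitution and embeddings *)

(** Suppose the companion [S] proved CH. A model of not-CH that shares the relevant sentences with
    [S] and [T] is placed in a chain of embeddings alternating with models of [S] and of [T]. Model
    completeness moves arbitrary statements between the models of [S]; plain embeddings move Delta_0
    facts, which are atomic in the signature, and values of Godel operations. CH in the first model
    [N0] of [S] gives a cardinal [x] and a function [f] that contradict not-CH in [M].

    The chain is built from diagrams and ultraproducts ([embeds_in_model],
    [model_embedded_in_theory]). Only [P], [P1], [P2] satisfy ZFC by construction, so formulas of
    [M] and of the models of [S] are read in a model of ZFC above them ([sat_atom]).

    The crux is to obtain, in [P], one set [e] assigning to each element of [x] an injection into
    omega ([enumeration_of_first_uncountable]). Its existence passes up to [N1] and back by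
    elementarity to [N0], so such an [e] lies in [M], and [value_in_substructure] extracts from it
    injections that belong to [M]. To identify [x] with the least uncountable ordinal [b] of [P],
    one must know that [b] is not collapsed in [P1] ([uncountable_preserved]): nothing in [P] codes
    a certain family of [b] distinct reals ([uncoded_exists]), a collapse of [b] would supply a real
    coding it ([coded_exists]), and yet every real of [P1] is a value of the function [f] of [P]. *)

Lemma scons0 (T : Type) n (x : T) (e : 'I_n -> T) : scons x e ord0 = x.
Proof. by rewrite /scons unlift_none. Qed.

Lemma sconsS (T : Type) n (x : T) (e : 'I_n -> T) i : scons x e (sh i) = e i.
Proof. by rewrite /scons liftK. Qed.

Definition sconsE := (scons0, sconsS).

Lemma scons_eta (T : Type) n (e : 'I_n.+1 -> T) :
  scons (e ord0) (fun i => e (sh i)) = e.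
Proof. by apply/funext => i; case: (unliftP ord0 i) => [j|] ->; rewrite !sconsE. Qed.

Lemma comp_scons (T U : Type) (h : T -> U) n (x : T) (e : 'I_n -> T) :
  (fun i => h (scons x e i)) = scons (h x) (fun i => h (e i)).
Proof. by apply/funext => i; case: (unliftP ord0 i) => [j|] ->; rewrite !sconsE. Qed.

Section Semantics.
Variable L : signature.
Implicit Types M N : structure L.

Lemma sat_fAll M n (e : 'I_n -> M) (p : formula L n.+1) :
  sat e (fAll p) = forall x, sat (scons x e) p.
Proof. by []. Qed.

Lemma sat_fEx M n (e : 'I_n -> M) (p : formula L n.+1) :
  sat e (fEx p) = exists x, sat (scons x e) p.
Proof. by []. Qed.

Lemma sat_fAnd M n (e : 'I_n -> M) (p q : formula L n) :
  sat e (fAnd p q) = (sat e p /\ sat e q).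
Proof. by []. Qed.

Lemma sat_fImp M n (e : 'I_n -> M) (p q : formula L n) :
  sat e (fImp p q) = (sat e p -> sat e q).
Proof. by []. Qed.

Lemma eval_tsubst M n m (s : 'I_n -> term L m) (e : 'I_m -> M) t :
  eval e (tsubst s t) = eval (fun i => eval e (s i)) t.
Proof.
by elim: t => //= f a IH; congr fct_of; apply/funext => j; exact: IH.
Qed.

Lemma eval_up M n m (s : 'I_n -> term L m) (e : 'I_m -> M) x :
  (fun i => eval (scons x e) (up s i)) = scons x (fun i => eval e (s i)).
Proof.
apply/funext => i; case: (unliftP ord0 i) => [j|] ->; rewrite /up !sconsE //=.
  rewrite eval_tsubst /=; congr eval; apply/funext => k; exact: sconsS.
by rewrite scons0.
Qed.

Lemma sat_subst M n m (s : 'I_n -> term L m) (e : 'I_m -> M) phi :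
  sat e (subst s phi) <-> sat (fun i => eval e (s i)) phi.
Proof.
elim: phi m s e => //= {n}.
- by move=> n t u m s e; rewrite !eval_tsubst.
- move=> n r a m s e; rewrite (_ : (fun j => _) =
    fun j => eval (fun i => eval e (s i)) (a j)) //.
  by apply/funext => j; rewrite eval_tsubst.
- by move=> n p IHp q IHq m s e; rewrite IHp IHq.
- by move=> n p IHp q IHq m s e; rewrite IHp IHq.
- by move=> n p IHp q IHq m s e; rewrite IHp IHq.
- by move=> n p IHp m s e; split=> H x; move: (H x); rewrite IHp eval_up.
- by move=> n p IHp m s e; split=> -[x H]; exists x; move: H; rewrite IHp eval_up.
Qed.

Lemma sat_rename M n m (r : 'I_n -> 'I_m) (e : 'I_m -> M) phi :
  sat e (rename r phi) <-> sat (fun i => e (r i)) phi.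
Proof. exact: sat_subst. Qed.

Lemma holds_univ_closure M n (phi : formula L n) :
  holds M (univ_closure phi) <-> forall e : 'I_n -> M, sat e phi.
Proof.
elim: n phi => [//|n IH] phi /=; rewrite IH; split=> H e /=.
  by rewrite -(scons_eta e); exact: H.
by move=> x; exact: H.
Qed.

Lemma universal_closure n (phi : formula L n) :
  universal phi -> universal (univ_closure phi).
Proof. by elim: n phi => //= n IH phi H; apply: IH. Qed.

Lemma universal_qf n (phi : formula L n) : quantifier_free phi -> universal phi.
Proof. by case: phi. Qed.

Lemma universal_comb n (phi : formula L n) : universal phi -> bool_comb_universal phi.
Proof. by case: phi => //= *; apply/orP; left. Qed.

Lemma quantifier_free_rename n m (r : 'I_n -> 'I_m) (phi : formula L n) :
  quantifier_free (rename r phi) = quantifier_free phi.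
Proof.
rewrite /rename; elim: phi m r => //= {n} n p IHp q IHq m r; by rewrite IHp IHq.
Qed.

Lemma embedding_comp M1 M2 M3 (h : M1 -> M2) (k : M2 -> M3) :
  embedding h -> embedding k -> embedding (k \o h).
Proof.
move=> [hi hr hf] [ki kr kf]; split; first exact: inj_comp.
- by move=> r a /=; rewrite kr hr.
- by move=> f a /=; rewrite hf kf.
Qed.

End Semantics.

(** * Ultraproducts and compactness *)

Section Ultraproduct.
Variables (L : signature) (I : Type) (N : I -> structure L).
Variables (U : set_system I).
Hypothesis UU : UltraFilter U.

Local Notation prod := (forall i, N i).

Let eqU (f g : prod) : Prop := U [set i | f i = g i].

Let eqU_refl f : eqU f f.
Proof. by apply: filterS filterT. Qed.

Let eqU_sym f g : eqU f g -> eqU g f.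
Proof. by apply: filterS. Qed.

Let eqU_trans f g k : eqU f g -> eqU g k -> eqU f k.
Proof. by apply: filterS2 => i /= ->. Qed.

Let up_carrier := {B : set prod | exists f, B = eqU f}.

Let cls (f : prod) : up_carrier := exist _ (eqU f) (ex_intro _ f erefl).

Let cls_eq f g : cls f = cls g <-> eqU f g.
Proof.
split=> [[->] //|fg]; apply: eq_exist; apply/funext => k; apply/propext.
split; first exact: eqU_trans (eqU_sym fg).
exact: eqU_trans fg.
Qed.

Let rep (B : up_carrier) : prod := sval (cid (svalP B)).

Let repK B : cls (rep B) = B.
Proof.
case: B => B [f hf]; apply: eq_exist.
by rewrite /rep; case: cid => g /= ->.
Qed.

Let rep_cls f : eqU (rep (cls f)) f.
Proof. by apply/cls_eq; exact: repK. Qed.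

Let up_inh : inhabited up_carrier.
Proof.
by constructor; apply: cls => i; exact: inhabited_witness (carrier_inhabited (N i)).
Qed.

Definition ultraproduct : structure L := @Structure L up_carrier up_inh
  (fun r a => U [set i | rel_of (fun j => rep (a j) i)])
  (fun f a => cls (fun i => fct_of (fun j => rep (a j) i))).

Definition up_class : prod -> ultraproduct := cls.

Let filter_forall_ord n (B : 'I_n -> set I) :
  (forall j, U (B j)) -> U [set i | forall j, B j i].
Proof.
elim: n B => [|n IH] B UB; first by apply: filterS filterT => i _ [].
have := IH _ (fun j => UB (sh j)); apply: filterS2 (UB ord0) => i B0 BS j.
by case: (unliftP ord0 j) => [k|] ->.
Qed.

Let eval_ultraproduct n (e : 'I_n -> prod) t :
  eval (fun j => up_class (e j)) t = up_class (fun i => eval (fun j => e j i) t).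
Proof.
elim: t => //= f a IH; apply/cls_eq; rewrite /eqU.
have H j : U [set i | rep (eval (fun j => up_class (e j)) (a j)) i =
    eval (fun j => e j i) (a j)].
  by rewrite IH; exact: rep_cls.
apply: filterS (filter_forall_ord H) => i /= Hi.
by congr fct_of; apply/funext => j; exact: Hi.
Qed.

Let up_ex (Q : ultraproduct -> Prop) : (exists x, Q x) <-> (exists f, Q (up_class f)).
Proof.
split=> [[x Qx]|[f Qf]]; last by exists (up_class f).
by exists (rep x); rewrite /up_class repK.
Qed.

Let ultraN (B : set I) : U (~` B) <-> ~ U B.
Proof.
split=> [UnB UB|nUB]; last by case: (in_ultra_setVsetC B UU).
by have [i []] := filter_ex (filterI UB UnB).
Qed.

Let sat_scons_up n (f : prod) (e : 'I_n -> prod) p :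
  sat (scons (up_class f) (fun j => up_class (e j))) p =
  sat (fun j => up_class (scons f e j)) p.
Proof. by rewrite (comp_scons up_class). Qed.

Let sat_scons_at n (f : prod) (e : 'I_n -> prod) i (p : formula L n.+1) :
  sat (fun j => scons f e j i) p = sat (scons (f i) (fun j => e j i)) p.
Proof. by rewrite (comp_scons (fun g : prod => g i)). Qed.

Lemma Los n (phi : formula L n) (e : 'I_n -> prod) :
  sat (fun j => up_class (e j)) phi <-> U [set i | sat (fun j => e j i) phi].
Proof.
elim: phi e => {n}.
- by move=> n t u e /=; rewrite !eval_ultraproduct; exact: cls_eq.
- move=> n r a e /=.
  have H j : U [set i | rep (eval (fun j => up_class (e j)) (a j)) i =
      eval (fun j => e j i) (a j)].
    by rewrite eval_ultraproduct; exact: rep_cls.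
  have {}H := filter_forall_ord H.
  by split; apply: filterS2 H => i /= /funext ->.
- by move=> n e /=; split=> // H; have [i []] := filter_ex H.
- move=> n p IHp q IHq e /=; rewrite IHp IHq; split=> [[Hp Hq]|H].
    exact: filterI.
  by split; apply: filterS H => i [].
- move=> n p IHp q IHq e /=; rewrite IHp IHq; split=> [[]|H].
  + by apply: filterS => i; left.
  + by apply: filterS => i; right.
  + apply: contrapT => /not_orP[/ultraN np /ultraN nq].
    by have [i [/= [hp|hq] [np' nq']]] := filter_ex (filterI H (filterI np nq)).
- move=> n p IHp q IHq e /=; rewrite IHp IHq; split=> [H|H].
    case: (pselect (U [set i | sat (e^~ i) p])) => [/H|/ultraN].
      by apply: filterS => i /= hq _.
    by apply: filterS => i /= np /np.
  by apply: filterS2 H => i /= H; apply: H.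
- move=> n p IHp e.
  rewrite sat_fAll; split=> [H|H x].
    apply: contrapT => /ultraN nU.
    have {}nU : U [set i | exists x, ~ sat (scons x (fun j => e j i)) p].
      by apply: filterS nU => i /existsNP.
    (* Choose a counterexample in each coordinate that has one and an arbitrary element elsewhere;
       the class of [f] then refutes the universal formula. *)
    pose f i : N i :=
      if pselect (exists x, ~ sat (scons x (fun j => e j i)) p) is left h
      then sval (cid h) else inhabited_witness (carrier_inhabited (N i)).
    have := H (up_class f); rewrite sat_scons_up IHp => Uf.
    have [i [+ hx]] := filter_ex (filterI Uf nU).
    rewrite /mkset sat_scons_at /f; case: pselect => // h.
    by case: cid.
  rewrite -(repK x) sat_scons_up IHp.
  by apply: filterS H => i H; rewrite /mkset sat_scons_at; exact: H.
- move=> n p IHp e; rewrite sat_fEx; split=> [/up_ex[f]|H].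
    rewrite sat_scons_up IHp; apply: filterS => i; rewrite /mkset sat_scons_at.
    by exists (f i).
  pose f i : N i :=
    if pselect (exists x, sat (scons x (fun j => e j i)) p) is left h
    then sval (cid h) else inhabited_witness (carrier_inhabited (N i)).
  exists (up_class f); rewrite sat_scons_up IHp.
  apply: filterS H => i h; rewrite /mkset sat_scons_at /f.
  by case: pselect => // h'; case: cid.
Qed.

End Ultraproduct.

(* The models [N l] of the finite lists of conditions have an ultraproduct in *)
(* which all the conditions hold at once.                                     *)
Lemma ultraproduct_of_lists (L : signature) (J : Type) (N : seq J -> structure L) :
  exists (M : structure L) (cls : (forall l, N l) -> M),
    forall n (phi : formula L n) (e : 'I_n -> forall l, N l) (s : seq J),
      (forall l, (forall j, List.In j s -> List.In j l) ->
        sat (fun i => e i l) phi) ->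
      sat (fun i => cls (e i)) phi.
Proof.
(* [F] is generated by the cones of lists containing a given [s]; it is proper because [s] lies in
   its own cone. *)
pose F : set_system (seq J) := fun B =>
  exists s, forall l, (forall j, List.In j s -> List.In j l) -> B l.
have FF : ProperFilter F.
  apply: Build_ProperFilter_ex; first by move=> B [s Bs]; exists s; exact: Bs.
  split=> [|B C [s Bs] [t Ct]|B C BC [s Bs]]; first by exists [::].
    exists (s ++ t) => l stl; split.
      by apply: Bs => j hj; apply: stl; apply/List.in_or_app; left.
    by apply: Ct => j hj; apply: stl; apply/List.in_or_app; right.
  by exists s => l sl; apply/BC/Bs.
have [U [UU FU]] := ultraFilterLemma FF.
exists (ultraproduct N U), (up_class U) => n phi e s H.
by apply/Los/FU; exists s.
Qed.

(** * The method of diagrams and compactness *)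

Section Embeddings.
Variable L : signature.

Definition fTrue n : formula L n := fImp fBot fBot.

Definition fConj n (s : seq (formula L n)) : formula L n := foldr fAnd (fTrue n) s.

Lemma sat_fConj (M : structure L) n (s : seq (formula L n)) (e : 'I_n -> M) :
  sat e (fConj s) <-> forall p, List.In p s -> sat e p.
Proof.
elim: s => [|p s IH] /=; first by split.
rewrite IH; split=> [[hp hs] q [<- //|/hs //]|H].
by split=> [|q hq]; apply: H; [left|right].
Qed.

Lemma quantifier_free_fConj n (s : seq (formula L n)) :
  (forall p, List.In p s -> quantifier_free p) -> quantifier_free (fConj s).
Proof.
elim: s => [//|p s IH] H /=; rewrite H; last by left.
by apply: IH => q hq; apply: H; right.
Qed.

Lemma bool_comb_universal_fConj (s : seq (sentence L)) :
  (forall p, List.In p s -> universal p) -> bool_comb_universal (fConj s).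
Proof.
elim: s => [//|p s IH] H /=; apply/orP; right; apply/andP; split.
  by apply: universal_comb; apply: H; left.
by apply: IH => q hq; apply: H; right.
Qed.

Record diagram (M : structure L) := Diagram {
  dia_n : nat;
  dia_e : 'I_dia_n -> M;
  dia_phi : formula L dia_n;
  dia_qf : quantifier_free dia_phi;
  dia_sat : sat dia_e dia_phi }.

Arguments Diagram {M dia_n}.

(** Each member of the list has its own tuple of variables; concatenating the tuples merges them
    into one quantifier-free formula true in [M]. A hypothesis about single formulas thus serves
    finite parts of the diagram. *)
Lemma diagram_conj (M : structure L) (l : seq (diagram M)) :
  exists d : diagram M, forall j, List.In j l -> forall (N : structure L) (g : M -> N),
    sat (fun i => g (dia_e (d := d) i)) (dia_phi d) ->
    sat (fun i => g (dia_e (d := j) i)) (dia_phi j).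
Proof.
elim: l => [|[n1 e1 p1 q1 s1] l [[n2 e2 p2 q2 s2] H]].
  pose e := fun _ : 'I_0 => inhabited_witness (carrier_inhabited M).
  have sT : sat e (fTrue 0) by [].
  by exists (Diagram e (fTrue 0) isT sT).
pose e i := match split i with inl a => e1 a | inr b => e2 b end.
have e1E i : e (lshift n2 i) = e1 i by rewrite /e (unsplitK (inl i)).
have e2E i : e (rshift n1 i) = e2 i by rewrite /e (unsplitK (inr i)).
pose p := fAnd (rename (@lshift n1 n2) p1) (rename (@rshift n1 n2) p2).
have qp : quantifier_free p by rewrite /= !quantifier_free_rename q1 q2.
have sp : sat e p.
  split; apply/sat_rename.
    by rewrite (_ : (fun i => _) = e1) //; apply/funext.
  by rewrite (_ : (fun i => _) = e2) //; apply/funext.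
exists (Diagram e p qp sp) => j /= [<-|jl] N g [h1 h2].
  move/sat_rename: h1 => /=; rewrite (_ : (fun i => _) = fun i => g (e1 i)) //.
  by apply/funext => i; rewrite e1E.
apply: H => //; move/sat_rename: h2 => /=.
rewrite (_ : (fun i => _) = fun i => g (e2 i)) //.
by apply/funext => i; rewrite e2E.
Qed.

Lemma In_mem (T : eqType) (x : T) s : x \in s -> List.In x s.
Proof. by elim: s => //= y s IH; rewrite inE => /orP[/eqP->|/IH]; [left|right]. Qed.

(* The conjuncts [x_i = x_k] make a realization of [phi] a map on the points. *)
Lemma diagram_map (M : structure L) (K : theory L) :
  (forall n (phi : formula L n) (e : 'I_n -> M), quantifier_free phi -> sat e phi ->
    exists2 N, model_of K N & exists e' : 'I_n -> N, sat e' phi) ->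
  forall n (phi : formula L n) (e : 'I_n -> M), quantifier_free phi -> sat e phi ->
    exists2 N, model_of K N & exists g : M -> N, sat (fun i => g (e i)) phi.
Proof.
move=> HK n phi e qphi sphi.
pose F (p : 'I_n * 'I_n) : formula L n :=
  if pselect (e p.1 = e p.2) then fEq (tVar p.1) (tVar p.2) else fTrue n.
pose eqs := fConj (List.map F (enum {: 'I_n * 'I_n})).
have qe : quantifier_free (fAnd phi eqs).
  rewrite /= qphi; apply: quantifier_free_fConj => q /List.in_map_iff[p [<- _]].
  by rewrite /F; case: pselect.
have se : sat e (fAnd phi eqs).
  split=> //; apply/sat_fConj => q /List.in_map_iff[p [<- _]].
  by rewrite /F; case: pselect => [h|_] /=.
have [N KN [e' [s1 /sat_fConj s2]]] := HK _ _ _ qe se.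
exists N => //.
pose g m : N := if pselect (exists i, e i = m) is left h then e' (sval (cid h))
  else inhabited_witness (carrier_inhabited N).
exists g; rewrite (_ : (fun i => g (e i)) = e') //; apply/funext => i.
rewrite /g; case: pselect => [h|[]]; last by exists i.
case: cid => k /= ek.
have ski : sat e' (F (k, i)).
  by apply: s2; apply: (List.in_map F); apply: In_mem; rewrite mem_enum.
by move: ski; rewrite /F /=; case: pselect.
Qed.

(** Every finite list of members of the diagram is realized by a map of [M] into a model of [K]. In
    the ultraproduct of these models all members hold at once, and preserving atomic formulas
    together with their negations makes the resulting map an embedding. *)
Lemma embeds_in_model (M : structure L) (K : theory L) :
  (forall n (phi : formula L n) (e : 'I_n -> M), quantifier_free phi -> sat e phi ->
    exists2 N, model_of K N & exists e' : 'I_n -> N, sat e' phi) ->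
  exists (N : structure L) (h : M -> N), model_of K N /\ embedding h.
Proof.
move=> /diagram_map HK.
have {}HK (l : seq (diagram M)) : exists Ng : {N : structure L & M -> N},
    model_of K (projT1 Ng) /\ forall j, List.In j l ->
      sat (fun i => projT2 Ng (dia_e (d := j) i)) (dia_phi j).
  have [[n e p qp sp] Hd] := diagram_conj l.
  have [N KN [g sg]] := HK _ p e qp sp.
  by exists (existT _ N g); split=> // j /Hd; apply.
pose Ng l := sval (cid (HK l)); pose N l := projT1 (Ng l).
pose g l : M -> N l := projT2 (Ng l).
have KN l : model_of K (N l) by case: (svalP (cid (HK l))).
have gP l j : List.In j l -> sat (fun i => g l (dia_e (d := j) i)) (dia_phi j).
  by case: (svalP (cid (HK l))) => _; apply.
have [P [cls clsP]] := ultraproduct_of_lists N.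
pose h m := cls (fun l => g l m).
have hP n (e : 'I_n -> M) p : quantifier_free p -> sat e p -> sat (fun i => h (e i)) p.
  move=> qp sp; apply: (clsP n p (fun i l => g l (e i)) [:: Diagram e p qp sp]).
  by move=> l Hl; have /= := gP l _ (Hl _ (or_introl erefl)); exact.
exists P, h; split.
  move=> p Kp e; rewrite (_ : e = fun i => cls (fun l =>
    inhabited_witness (carrier_inhabited (N l)))); last by apply/funext => -[].
  by apply: (clsP 0 p _ [::]) => l _; exact: KN.
split.
- move=> m m' hm; apply: contrapT => mm'.
  pose e := scons m (fun _ : 'I_1 => m').
  have := @hP 2 e (fNot (fEq (tVar v0) (tVar v1))) isT.
  by rewrite /= /e !sconsE; apply.
- move=> r a; split=> Ha.
    apply: contrapT => nra.
    by have /= := @hP _ a (fNot (fRel r tVar)) isT; apply.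
  exact: (@hP _ a (fRel r tVar) isT).
(* With the value placed at index 0, the equation between [x_0] and [f] applied to the remaining
   variables belongs to the diagram. *)
- move=> f a; pose e := scons (fct_of a) a.
  have := @hP _ e (fEq (tVar v0) (tApp f (fun j => tVar (sh j)))) isT.
  rewrite /= /e scons0 => H; rewrite H.
    by congr fct_of; apply/funext => j; rewrite sconsS.
  by congr fct_of; apply/funext => j; rewrite sconsS.
Qed.

(** The ultraproduct satisfies [K] because all factors do, and a given member of [G] because it
    holds in every factor whose list contains it. *)
Lemma compactness (M : structure L) (K G : theory L) :
  (forall l, (forall p, List.In p l -> G p) ->
    exists2 N, model_of K N & forall p, List.In p l -> holds N p) ->
  exists2 N : structure L, model_of K N & model_of G N.
Proof.
move=> HK.
pose J := {p : sentence L | G p}.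
have {}HK (l : seq J) : exists N : structure L, model_of K N /\
    forall j, List.In j l -> holds N (sval j).
  have [p|N KN Hl] := HK (List.map sval l).
    by move=> /List.in_map_iff[j [<- _]]; exact: (svalP j).
  by exists N; split=> // j jl; apply: Hl; exact: List.in_map.
pose N l := sval (cid (HK l)).
have [P [cls clsP]] := ultraproduct_of_lists N.
have PP p (s : seq J) : (forall l, (forall j, List.In j s -> List.In j l) ->
    holds (N l) p) -> holds P p.
  move=> Hs e; rewrite (_ : e = fun i => cls (fun l =>
    inhabited_witness (carrier_inhabited (N l)))); last by apply/funext => -[].
  by apply: (clsP 0 p _ s) => l /Hs; exact.
exists P => p Hp.
  by apply: (PP p [::]) => l _; have [+ _] := svalP (cid (HK l)); exact.
apply: (PP p [:: exist _ p Hp]) => l Hl.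
have [_ /(_ (exist _ p Hp))] := svalP (cid (HK l)); apply.
by apply: Hl; left.
Qed.

End Embeddings.

(** * Embeddings obtained from shared universal sentences and their boolean combinations *)

Section AbsoluteModelCompanion.
Variable L : signature.
Implicit Types (M : structure L) (S T K : theory L).

(** If a quantifier-free formula true at a tuple of [M] were realized in no model of [T], the
    universal closure of its negation would follow from [T] and hence hold in [M]. *)
Lemma embeds_in_model_of_universal_part T M :
  model_of (forall_or_exists_part T) M ->
  exists (N : structure L) (h : M -> N), model_of T N /\ embedding h.
Proof.
move=> MT; apply: embeds_in_model => n phi e qphi sphi; apply: contrapT => nN.
have : holds M (univ_closure (fNot phi)).
  apply: MT; split.
    by apply/universal_comb/universal_closure/universal_qf; rewrite /= qphi.
  move=> N TN; apply/holds_univ_closure => e' se'.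
  by apply: nN; exists N => //; exists e'.
by move/holds_univ_closure => /(_ e) /=; apply.
Qed.

Lemma model_forall_or_exists_part T M : model_of T M -> model_of (forall_or_exists_part T) M.
Proof. by move=> TM p [_ Tp]; exact: Tp. Qed.

(* [N] is taken to satisfy the universal sentences of [M]; then every finite *)
(* part of its diagram is realized in [M].                                   *)
Lemma model_embedded_in_theory T K M :
  model_of (forall_or_exists_part T) M -> model_of K M ->
  exists (N N' : structure L) (h : N -> N'), [/\ model_of T N, model_of K N' & embedding h].
Proof.
move=> MT MK.
have [N TN NU] : exists2 N, model_of T N &
    model_of [set p | universal p /\ holds M p] N.
  apply: (compactness M) => l Hl; apply: contrapT => nN.
  (* The negation of a conjunction of universal sentences is in general not universal: here boolean
     combinations are what makes the consequence of [T] pass to [M]. *)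
  have : holds M (fNot (fConj l)).
    apply: MT; split.
      by rewrite /= bool_comb_universal_fConj ?orbT // => p /Hl[].
    move=> N TN e /sat_fConj sl; apply: nN; exists N => // p pl e'.
    by rewrite (_ : e' = e); [exact: sl|apply/funext => -[]].
  move=> /(_ (fun=> inhabited_witness (carrier_inhabited M))) /=; apply.
  by apply/sat_fConj => p /Hl[_]; exact.
have [N' [h [KN' hh]]] : exists (N' : structure L) (h : N -> N'),
    model_of K N' /\ embedding h.
  apply: embeds_in_model => n phi e qphi sphi; exists M => //.
  apply: contrapT => nM; have : holds N (univ_closure (fNot phi)).
    apply: NU; split.
      by apply/universal_closure/universal_qf; rewrite /= qphi.
    by apply/holds_univ_closure => e' se'; apply: nM; exists e'.
  by move/holds_univ_closure => /(_ e) /=; apply.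
by exists N, N', h.
Qed.

End AbsoluteModelCompanion.

(** * Definability in models of set theory *)

Definition mem_in (V : structure sig_in) (a b : V) : Prop :=
  @rel_of sig_in V tt (tnth [tuple a; b]).

Local Notation "a \e b" := (mem_in a b) (at level 70, no associativity).

Lemma sat_mem (V : structure sig_in) n (x y : 'I_n) (e : 'I_n -> V) :
  sat e (mem_fm x y) = (e x \e e y).
Proof.
rewrite /= /mem_in; congr rel_of; apply/funext => j.
by case: (unliftP ord0 j) => [k|] ->; rewrite !(tnth_nth (e x)) //= ?(tnth_nth (tVar x)) //= ord1.
Qed.

Arguments mem_fm : simpl never.

Section Specifications.
Variables (L : signature) (V : structure L) (n : nat) (e : 'I_n -> V).

Lemma spec_bot : sat e (fBot : formula L n) <-> False.
Proof. by []. Qed.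

Lemma spec_and (p q : formula L n) P Q :
  (sat e p <-> P) -> (sat e q <-> Q) -> sat e (fAnd p q) <-> P /\ Q.
Proof. by move=> /= -> ->. Qed.

Lemma spec_or (p q : formula L n) P Q :
  (sat e p <-> P) -> (sat e q <-> Q) -> sat e (fOr p q) <-> P \/ Q.
Proof. by move=> /= -> ->. Qed.

Lemma spec_imp (p q : formula L n) (P Q : Prop) :
  (sat e p <-> P) -> (sat e q <-> Q) -> sat e (fImp p q) <-> (P -> Q).
Proof. by move=> /= -> ->. Qed.

Lemma spec_not (p : formula L n) (P : Prop) : (sat e p <-> P) -> sat e (fNot p) <-> ~ P.
Proof. by move=> /= ->. Qed.

Lemma spec_iff (p q : formula L n) (P Q : Prop) :
  (sat e p <-> P) -> (sat e q <-> Q) -> sat e (fIff p q) <-> (P <-> Q).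
Proof. by move=> /= -> ->. Qed.

Lemma spec_all (p : formula L n.+1) (Q : V -> Prop) :
  (forall x, sat (scons x e) p <-> Q x) -> sat e (fAll p) <-> forall x, Q x.
Proof. by move=> H; split=> h x; apply/H. Qed.

Lemma spec_ex (p : formula L n.+1) (Q : V -> Prop) :
  (forall x, sat (scons x e) p <-> Q x) -> sat e (fEx p) <-> exists x, Q x.
Proof. by move=> H; split=> -[x /H h]; exists x. Qed.

Lemma spec_holds (p : formula L n) Q : sat e p -> (sat e p <-> Q) -> Q.
Proof. by move=> h <-. Qed.

End Specifications.

Section SetSpecifications.
Variables (V : structure sig_in) (n : nat) (e : 'I_n -> V).

Lemma spec_mem (x y : 'I_n) a b : e x = a -> e y = b -> sat e (mem_fm x y) <-> a \e b.
Proof. by rewrite sat_mem => -> ->. Qed.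

Lemma spec_eq (x y : 'I_n) a b : e x = a -> e y = b -> sat e (eq_fm x y) <-> a = b.
Proof. by move=> /= -> ->. Qed.

Lemma spec_ball (x : 'I_n) (p : form n.+1) a (Q : V -> Prop) :
  e x = a -> (forall y, sat (scons y e) p <-> Q y) ->
  sat e (ball x p) <-> forall y, y \e a -> Q y.
Proof.
move=> <- H; rewrite /ball sat_fAll; split=> h y; move: (h y); rewrite sat_fImp sat_mem !sconsE.
  by move=> {}h /h /H.
by move=> {}h /h /H.
Qed.

Lemma spec_bex (x : 'I_n) (p : form n.+1) a (Q : V -> Prop) :
  e x = a -> (forall y, sat (scons y e) p <-> Q y) ->
  sat e (bex x p) <-> exists y, y \e a /\ Q y.
Proof.
move=> <- H; rewrite /bex sat_fEx; split=> -[y h]; exists y; move: h.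
  by rewrite sat_fAnd sat_mem !sconsE => -[? /H].
by rewrite sat_fAnd sat_mem !sconsE => -[? /H].
Qed.

End SetSpecifications.

(** Translates a formula into its meaning connective by connective. The rules record the value of
    each variable as an equation, so that de Bruijn indices disappear from the result. *)
Ltac spec1 := lazymatch goal with
  | |- sat _ (mem_fm _ _) <-> _ => apply: spec_mem; [by rewrite ?sconsE | by rewrite ?sconsE]
  | |- sat _ (eq_fm _ _) <-> _ => apply: spec_eq; [by rewrite ?sconsE | by rewrite ?sconsE]
  | |- sat _ (ball _ _) <-> _ => apply: spec_ball; [by rewrite ?sconsE | move=> ?]
  | |- sat _ (bex _ _) <-> _ => apply: spec_bex; [by rewrite ?sconsE | move=> ?]
  | |- sat _ fBot <-> _ => exact: spec_bot
  | |- sat _ (fIff _ _) <-> _ => apply: spec_iff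
  | |- sat _ (fAnd _ _) <-> _ => apply: spec_and
  | |- sat _ (fOr _ _) <-> _ => apply: spec_or
  | |- sat _ (fNot _) <-> _ => apply: spec_not
  | |- sat _ (fImp _ _) <-> _ => apply: spec_imp
  | |- sat _ (fAll _) <-> _ => apply: spec_all => ?
  | |- sat _ (fEx _) <-> _ => apply: spec_ex => ?
  end.
Ltac spec := repeat spec1.

Section Definability.
Variable V : structure sig_in.

Definition asg k (g : 'I_k -> V) (s : 'I_k + V) : V :=
  match s with inl j => g j | inr c => c end.

(** Definability with parameters: [s] sends each variable of the formula to an argument or to an
    element of [V]. This allows Separation to be applied to predicates of the metatheory, with
    definability checked from their shape. *)
Definition definable k (Q : ('I_k -> V) -> Prop) : Prop :=
  exists n (phi : form n) (s : 'I_n -> 'I_k + V),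
    forall g, Q g <-> sat (fun i => asg g (s i)) phi.

Definition is_var k (t : ('I_k -> V) -> V) : Prop :=
  exists s : 'I_k + V, t = fun g => asg g s.

Lemma is_var_proj k i : is_var (fun g : 'I_k -> V => g i).
Proof. by exists (inl i). Qed.

Lemma is_var_const k c : is_var (fun _ : 'I_k -> V => c).
Proof. by exists (inr c). Qed.

Let pair_asg k n1 n2 (s1 : 'I_n1 -> 'I_k + V) (s2 : 'I_n2 -> 'I_k + V) :=
  fun i => match split i with inl a => s1 a | inr b => s2 b end.

Let pair_asgl k n1 n2 (s1 : 'I_n1 -> 'I_k + V) (s2 : 'I_n2 -> 'I_k + V) i :
  pair_asg s1 s2 (lshift n2 i) = s1 i.
Proof. by rewrite /pair_asg (unsplitK (inl i)). Qed.

Let pair_asgr k n1 n2 (s1 : 'I_n1 -> 'I_k + V) (s2 : 'I_n2 -> 'I_k + V) i :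
  pair_asg s1 s2 (rshift n1 i) = s2 i.
Proof. by rewrite /pair_asg (unsplitK (inr i)). Qed.

Let definable_pair k (Q1 Q2 : ('I_k -> V) -> Prop) : definable Q1 -> definable Q2 ->
  exists n (p1 p2 : form n) (s : 'I_n -> 'I_k + V), forall g,
    (Q1 g <-> sat (fun i => asg g (s i)) p1) /\
    (Q2 g <-> sat (fun i => asg g (s i)) p2).
Proof.
move=> [n1 [p1 [s1 H1]]] [n2 [p2 [s2 H2]]].
exists (n1 + n2), (rename (@lshift n1 n2) p1), (rename (@rshift n1 n2) p2),
  (pair_asg s1 s2) => g; rewrite !sat_rename H1 H2; split.
  by under eq_fun do rewrite -(pair_asgl s1 s2).
by under eq_fun do rewrite -(pair_asgr s1 s2).
Qed.

Lemma definable_and k (Q1 Q2 : ('I_k -> V) -> Prop) :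
  definable Q1 -> definable Q2 -> definable (fun g => Q1 g /\ Q2 g).
Proof.
move=> /definable_pair H /H[n [p1 [p2 [s {}H]]]]; exists n, (fAnd p1 p2), s => g /=.
by have [-> ->] := H g.
Qed.

Lemma definable_or k (Q1 Q2 : ('I_k -> V) -> Prop) :
  definable Q1 -> definable Q2 -> definable (fun g => Q1 g \/ Q2 g).
Proof.
move=> /definable_pair H /H[n [p1 [p2 [s {}H]]]]; exists n, (fOr p1 p2), s => g /=.
by have [-> ->] := H g.
Qed.

Lemma definable_imp k (Q1 Q2 : ('I_k -> V) -> Prop) :
  definable Q1 -> definable Q2 -> definable (fun g => Q1 g -> Q2 g).
Proof.
move=> /definable_pair H /H[n [p1 [p2 [s {}H]]]]; exists n, (fImp p1 p2), s => g /=.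
by have [-> ->] := H g.
Qed.

Lemma definable_false k : definable (fun _ : 'I_k -> V => False).
Proof. by exists k, fBot, inl. Qed.

Lemma definable_not k (Q : ('I_k -> V) -> Prop) : definable Q -> definable (fun g => ~ Q g).
Proof. by move=> DQ; apply: definable_imp DQ _; exact: definable_false. Qed.

Lemma definable_iff k (Q1 Q2 : ('I_k -> V) -> Prop) :
  definable Q1 -> definable Q2 -> definable (fun g => Q1 g <-> Q2 g).
Proof. by move=> D1 D2; apply: definable_and; exact: definable_imp. Qed.

Let definable_binder k (Q : ('I_k.+1 -> V) -> Prop) : definable Q ->
  exists n (p : form n.+1) (s : 'I_n -> 'I_k + V), forall g x,
    Q (scons x g) <-> sat (scons x (fun i => asg g (s i))) p.
Proof.
move=> [n [p [s H]]].
(* All variables standing for the argument to be bound are merged into index 0; the slots they leave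
   free are filled by [s'] with an arbitrary value. *)
pose r i : 'I_n.+1 := match s i with
  | inl j => if unlift ord0 j is Some _ then sh i else ord0 | inr _ => sh i end.
pose s' i : 'I_k + V := match s i with
  | inl j => if unlift ord0 j is Some j' then inl j'
             else inr (inhabited_witness (carrier_inhabited V))
  | inr c => inr c end.
exists n, (rename r p), s' => g x; rewrite sat_rename H.
rewrite (_ : (fun i => _) = (fun i => scons x (fun i => asg g (s' i)) (r i))) //.
apply/funext => i; rewrite /r; case E: (s i) => [j|c] /=; last first.
  by rewrite sconsS /s' E.
case: (unliftP ord0 j) => [j'|] Ej; rewrite Ej in E *; last by rewrite !scons0.
by rewrite !sconsS /s' E liftK.
Qed.

Lemma definable_all k (Q : ('I_k -> V) -> V -> Prop) :
  definable (fun g : 'I_k.+1 -> V => Q (fun i => g (sh i)) (g ord0)) ->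
  definable (fun g => forall x, Q g x).
Proof.
move=> /definable_binder[n [p [s H]]]; exists n, (fAll p), s => g; rewrite sat_fAll.
have E x : (fun i => scons x g (sh i)) = g by apply/funext => i; rewrite sconsS.
by split=> h x; move: (h x) (H g x); rewrite E scons0; tauto.
Qed.

Lemma definable_ex k (Q : ('I_k -> V) -> V -> Prop) :
  definable (fun g : 'I_k.+1 -> V => Q (fun i => g (sh i)) (g ord0)) ->
  definable (fun g => exists x, Q g x).
Proof.
move=> /definable_binder[n [p [s H]]]; exists n, (fEx p), s => g; rewrite sat_fEx.
have E x : (fun i => scons x g (sh i)) = g by apply/funext => i; rewrite sconsS.
by split=> -[x h]; exists x; move: h (H g x); rewrite E scons0; tauto.
Qed.

Let definable_mem_var k (s t : ('I_k -> V) -> V) :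
  is_var s -> is_var t -> definable (fun g => s g \e t g).
Proof.
move=> [a ->] [b ->]; exists 2, (mem_fm v0 v1), (scons a (fun=> b)) => g.
by rewrite sat_mem !sconsE.
Qed.

Let definable_eq_var k (s t : ('I_k -> V) -> V) :
  is_var s -> is_var t -> definable (fun g => s g = t g).
Proof.
move=> [a ->] [b ->]; exists 2, (eq_fm v0 v1), (scons a (fun=> b)) => g.
by rewrite /= !sconsE.
Qed.

Let definable_rename k m (r : 'I_k -> 'I_m + V) (Q : ('I_k -> V) -> Prop) :
  definable Q -> definable (fun g : 'I_m -> V => Q (fun i => asg g (r i))).
Proof.
move=> [n [p [s H]]].
exists n, p, (fun i => match s i with inl j => r j | inr c => inr c end) => g.
rewrite H (_ : (fun i => _) = (fun i => asg g
  match s i with inl j => r j | inr c => inr c end)) //.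
by apply/funext => i; case: (s i).
Qed.

(** A term is given by its definable graph, so that compound terms such as ordered pairs can be
    substituted by quantifying existentially over their values. *)
Definition definable_term k (t : ('I_k -> V) -> V) : Prop :=
  definable (fun g : 'I_k.+1 -> V => g ord0 = t (fun i => g (sh i))).

Lemma definable_term_proj k i : definable_term (fun g : 'I_k -> V => g i).
Proof. by apply: definable_eq_var; [exact: is_var_proj|exact: is_var_proj]. Qed.

Lemma definable_term_const k c : definable_term (fun _ : 'I_k -> V => c).
Proof. by apply: definable_eq_var; [exact: is_var_proj|exact: is_var_const]. Qed.

Let definable_term_shift k (t : ('I_k -> V) -> V) :
  definable_term t -> definable_term (fun g : 'I_k.+1 -> V => t (fun i => g (sh i))).
Proof.
pose r : 'I_k.+1 -> 'I_k.+2 + V := scons (inl ord0) (fun i => inl (sh (sh i))).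
move=> /(definable_rename r)[n [p [s H]]]; exists n, p, s => g; rewrite -H.
rewrite (_ : (fun i => asg g (r (sh i))) = fun i => g (sh (sh i))).
  by rewrite /r scons0.
by apply/funext => i; rewrite /r sconsS.
Qed.

Lemma definable_ext k (Q Q' : ('I_k -> V) -> Prop) :
  (forall g, Q g <-> Q' g) -> definable Q -> definable Q'.
Proof. by move=> QQ [n [p [s H]]]; exists n, p, s => g; rewrite -QQ. Qed.

Lemma definable_comp1 k (R : V -> Prop) (s : ('I_k -> V) -> V) :
  definable (fun g : 'I_1 -> V => R (g ord0)) -> definable_term s -> definable (fun g => R (s g)).
Proof.
move=> DR Ds; apply: (definable_ext (Q := fun g => exists x, x = s g /\ R x)) => [g|].
  by split=> [[x [->]]//|h]; exists (s g).
apply: definable_ex; apply: definable_and Ds _.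
exact: (definable_rename (fun=> inl ord0) DR).
Qed.

Lemma definable_comp2 k (R : V -> V -> Prop) (s t : ('I_k -> V) -> V) :
  definable (fun g : 'I_2 -> V => R (g v0) (g v1)) -> definable_term s -> definable_term t ->
  definable (fun g => R (s g) (t g)).
Proof.
move=> DR Ds Dt.
apply: (definable_ext (Q := fun g => exists x, x = s g /\ exists y, y = t g /\ R x y)).
  by move=> g; split=> [[x [-> [y [->]]]]//|h]; exists (s g); split=> //; exists (t g).
apply: definable_ex; apply: definable_and Ds _.
apply: definable_ex; apply: definable_and (definable_term_shift Dt) _.
apply: definable_ext (definable_rename (scons (inl v1) (fun=> inl v0)) DR) => g.
by rewrite !sconsE.
Qed.

Lemma definable_mem k (s t : ('I_k -> V) -> V) :
  definable_term s -> definable_term t -> definable (fun g => s g \e t g).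
Proof.
by apply: definable_comp2; apply: definable_mem_var; exact: is_var_proj.
Qed.

Lemma definable_eq k (s t : ('I_k -> V) -> V) :
  definable_term s -> definable_term t -> definable (fun g => s g = t g).
Proof.
by apply: definable_comp2; apply: definable_eq_var; exact: is_var_proj.
Qed.

Lemma definable_term_comp2 k (F : V -> V -> V) (s t : ('I_k -> V) -> V) :
  definable_term (fun g : 'I_2 -> V => F (g v0) (g v1)) -> definable_term s -> definable_term t ->
  definable_term (fun g => F (s g) (t g)).
Proof.
move=> DF Ds Dt.
apply: (definable_ext (Q := fun g : 'I_k.+1 -> V => exists x, x = s (fun i => g (sh i)) /\
   exists y, y = t (fun i => g (sh i)) /\ g ord0 = F x y)).
  by move=> g; split=> [[x [-> [y [->]]]]//|h]; eexists; split=> //; eexists.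
apply: definable_ex; apply: definable_and (definable_term_shift Ds) _.
apply: definable_ex; apply: definable_and (definable_term_shift (definable_term_shift Dt)) _.
apply: definable_ext (definable_rename (scons (inl v2) (scons (inl v1) (fun=> inl v0))) DF) => g.
by rewrite !sconsE.
Qed.

End Definability.

Ltac def1 := lazymatch goal with
  | |- definable (fun _ => False) => exact: definable_false
  | |- definable (fun g => @?P g /\ @?Q g) => apply: definable_and
  | |- definable (fun g => @?P g \/ @?Q g) => apply: definable_or
  | |- definable (fun g => @?P g <-> @?Q g) => apply: definable_iff
  | |- definable (fun g => ~ @?P g) => apply: definable_not
  | |- definable (fun g => @ex _ (@?P g)) => apply: definable_ex
  | |- definable (fun g => mem_in (@?P g) (@?Q g)) => apply: definable_mem
  | |- definable (fun g => @?P g = @?Q g) => apply: definable_eq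
  | |- definable (fun g => @?P g -> @?Q g) => apply: definable_imp
  | |- definable (fun g => forall x, @?P g x) => apply: definable_all
  | |- definable_term (fun g => g _) => exact: definable_term_proj
  | |- definable_term (fun _ => ?c) => exact: definable_term_const
  end.
Ltac def := repeat def1.

(** * Elementary set theory in a model of ZFC *)

(** Total on every structure, with junk value [a] where no pair exists, so that notions built on
    [opr] can be stated without carrying a proof of ZFC. The same holds for [sep]. *)
Definition pairset (V : structure sig_in) (a b : V) : V :=
  if pselect (exists z, forall x, x \e z <-> x = a \/ x = b) is left h
  then sval (cid h) else a.

Definition opr (V : structure sig_in) (a b : V) : V :=
  pairset (pairset a a) (pairset a b).

Definition sep (V : structure sig_in) (a : V) (Q : V -> Prop) : V :=
  if pselect (exists b, forall z, z \e b <-> z \e a /\ Q z) is left h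
  then sval (cid h) else a.

Section SetTheory.
Variable V : structure sig_in.
Hypothesis HV : model_of ZFC V.
Implicit Types a b c f u v w x y z : V.

Let e0 : 'I_0 -> V := fun=> inhabited_witness (carrier_inhabited V).

Lemma mem_ext a b : (forall z, z \e a <-> z \e b) -> a = b.
Proof.
suff: forall a b, (forall z, z \e a <-> z \e b) -> a = b by apply.
by apply: (spec_holds (HV ZFC_extensionality e0)); rewrite /ax_extensionality; spec.
Qed.

Lemma foundation a : (exists x, x \e a) -> exists y, y \e a /\ forall z, z \e a -> ~ z \e y.
Proof.
move: a; suff: forall a, (exists x, x \e a) ->
  exists y, y \e a /\ forall z, z \e a -> ~ z \e y by apply.
by apply: (spec_holds (HV ZFC_foundation e0)); rewrite /ax_foundation; spec.
Qed.

(** The parameters of the definition fill the universally closed variables of the axiom; the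
    variables standing for [z] are renamed to index 0. *)
Lemma separation a (Q : V -> Prop) : definable (fun g : 'I_1 -> V => Q (g ord0)) ->
  exists b, forall z, z \e b <-> z \e a /\ Q z.
Proof.
move=> [n [p [s H]]].
have H1 z : Q z <-> sat (fun i => asg (fun _ : 'I_1 => z) (s i)) p by rewrite -H.
pose r i : 'I_n.+1 := match s i with inl _ => ord0 | inr _ => sh i end.
pose c i : V := match s i with inl _ => a | inr c => c end.
have H2 z : Q z <-> sat (scons z c) (rename r p).
  rewrite sat_rename H1 (_ : (fun i => _) = (fun i => scons z c (r i))) //.
  by apply/funext => i; rewrite /r /c; case E: (s i); rewrite ?scons0 ?sconsS ?E.
have /holds_univ_closure/(_ c) := HV (@ZFC_separation n (rename r p)).
suff E : sat c (fAll (fEx (fAll (fIff (mem_fm v0 v1) (fAnd (mem_fm v0 v2)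
    (rename (scons v0 (fun i => sh (sh (sh i)))) (rename r p))))))) <->
    forall a, exists b, forall z, z \e b <-> z \e a /\ Q z.
  by move/E; apply.
apply: spec_all => a1; apply: spec_ex => b1; apply: spec_all => z; spec; rewrite H2 sat_rename.
rewrite (_ : (fun i => _) = scons z c) //; apply/funext => i.
by case: (unliftP ord0 i) => [j|] ->; rewrite !sconsE.
Qed.

Lemma sepP a (Q : V -> Prop) : definable (fun g : 'I_1 -> V => Q (g ord0)) ->
  forall z, z \e sep a Q <-> z \e a /\ Q z.
Proof.
by move=> /(separation a) h z; rewrite /sep; case: pselect => // {}h; case: cid.
Qed.

Lemma pairsetP a b x : x \e pairset a b <-> x = a \/ x = b.
Proof.
rewrite /pairset; case: pselect => [h|[]]; first by case: cid.
move: a b; suff: forall a b, exists z, forall x, x \e z <-> x = a \/ x = b by apply.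
by apply: (spec_holds (HV ZFC_pairing e0)); rewrite /ax_pairing; spec.
Qed.

Lemma union_ex a : exists b, forall z, z \e b <-> exists y, y \e a /\ z \e y.
Proof.
move: a; suff: forall a, exists b, forall z, z \e b <-> exists y, y \e a /\ z \e y by apply.
by apply: (spec_holds (HV ZFC_union e0)); rewrite /ax_union; spec.
Qed.

Definition Union a : V := sval (cid (union_ex a)).

Lemma UnionP a z : z \e Union a <-> exists y, y \e a /\ z \e y.
Proof. by rewrite /Union; case: cid. Qed.

Definition subset_in a b : Prop := forall z, z \e a -> z \e b.

Lemma power_ex a : exists b, forall z, z \e b <-> subset_in z a.
Proof.
move: a; suff: forall a, exists b, forall z, z \e b <-> subset_in z a by apply.
by apply: (spec_holds (HV ZFC_powerset e0)); rewrite /ax_powerset /subset_fm; spec.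
Qed.

Definition Power a : V := sval (cid (power_ex a)).

Lemma PowerP a z : z \e Power a <-> subset_in z a.
Proof. by rewrite /Power; case: cid. Qed.

Lemma definable_term_pairset k (s t : ('I_k -> V) -> V) :
  definable_term s -> definable_term t -> definable_term (fun g => pairset (s g) (t g)).
Proof.
apply: definable_term_comp2.
apply: (definable_ext (Q := fun g => forall x, x \e g ord0 <-> x = g v1 \/ x = g v2)); last by def.
move=> g; split=> [H|->]; last exact: pairsetP.
by apply: mem_ext => z; rewrite pairsetP.
Qed.

Lemma definable_term_pr k (s t : ('I_k -> V) -> V) :
  definable_term s -> definable_term t -> definable_term (fun g => opr (s g) (t g)).
Proof. by move=> Ds Dt; do 2!apply: definable_term_pairset => //. Qed.

Lemma pairset_inj a b c : pairset a b = pairset a c -> b = c.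
Proof.
move=> H; have Hz z : z = a \/ z = b <-> z = a \/ z = c by rewrite -!pairsetP H.
by case: (iffLR (Hz b) (or_intror erefl)) (iffRL (Hz c) (or_intror erefl)) =>
  [->|->] // [->|->].
Qed.

Lemma opr_inj a b c d : opr a b = opr c d -> a = c /\ b = d.
Proof.
move=> H.
have Hz z : z = pairset a a \/ z = pairset a b <-> z = pairset c c \/ z = pairset c d.
  by rewrite -!pairsetP -/(opr a b) H.
have ac : a = c.
  case: (iffLR (Hz (pairset a a)) (or_introl erefl)) => E.
    by have : a \e pairset c c; [rewrite -E pairsetP; left|rewrite pairsetP => -[]].
  by have : c \e pairset a a; [rewrite E pairsetP; left|rewrite pairsetP => -[]].
split=> //; subst c; exact: pairset_inj (pairset_inj H).
Qed.

Definition suc a : V := Union (pairset a (pairset a a)).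

Lemma sucP a z : z \e suc a <-> z \e a \/ z = a.
Proof.
rewrite UnionP; split=> [[y [/pairsetP[->|->]]]|[h|->]]; first by left.
- by move/pairsetP => [->|->]; right.
- by exists a; split=> //; apply/pairsetP; left.
- by exists (pairset a a); split; apply/pairsetP; [right|left].
Qed.

Lemma definable_term_suc k (s : ('I_k -> V) -> V) :
  definable_term s -> definable_term (fun g => suc (s g)).
Proof.
move=> Ds; apply: (@definable_term_comp2 _ _ (fun a _ => suc a) s s) => //.
apply: (definable_ext (Q := fun g => forall x, x \e g ord0 <-> x \e g v1 \/ x = g v1)); last by def.
move=> g; split=> [H|->]; last exact: sucP.
by apply: mem_ext => z; rewrite sucP.
Qed.

Ltac sdef := repeat lazymatch goal with
  | |- definable_term (fun g => pairset (@?P g) (@?Q g)) => apply: definable_term_pairset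
  | |- definable_term (fun g => opr (@?P g) (@?Q g)) => apply: definable_term_pr
  | |- definable_term (fun g => suc (@?P g)) => apply: definable_term_suc
  | _ => def1
  end.

Definition cartesian a b : V := sep (Power (Power (Union (pairset a b))))
  (fun z => exists u v, z = opr u v /\ u \e a /\ v \e b).

Lemma prodP a b z : z \e cartesian a b <-> exists u v, z = opr u v /\ u \e a /\ v \e b.
Proof.
have [] := @sepP (Power (Power (Union (pairset a b))))
  (fun z => exists u v, z = opr u v /\ u \e a /\ v \e b) _ z.
  by sdef.
move=> H1 H2; split=> [/H1[]//|H]; apply: H2; split=> //.
case: H => u [v [-> [ua vb]]].
have hu : u \e Union (pairset a b) by apply/UnionP; exists a; rewrite pairsetP; split=> //; left.
have hv : v \e Union (pairset a b) by apply/UnionP; exists b; rewrite pairsetP; split=> //; right.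
apply/PowerP => w /pairsetP[->|->]; apply/PowerP => x /pairsetP[->|->] //.
Qed.

Lemma mem_prod a b u v : opr u v \e cartesian a b <-> u \e a /\ v \e b.
Proof.
rewrite prodP; split=> [[u' [v' [/opr_inj[-> ->]]]] //|?].
by exists u, v.
Qed.

Definition function_on f x : Prop :=
  (forall p, p \e f -> exists u v, u \e x /\ p = opr u v) /\
  (forall u, u \e x -> exists v, opr u v \e f) /\
  (forall u v w, u \e x -> opr u v \e f -> opr u w \e f -> v = w).

Definition injective_in g x y : Prop :=
  function_on g x /\
  (forall u, u \e x -> exists v, v \e y /\ opr u v \e g) /\
  (forall u u' v, u \e x -> u' \e x -> v \e y ->
    opr u v \e g -> opr u' v \e g -> u = u').

Definition is_ordinal a : Prop :=
  (forall x, x \e a -> subset_in x a) /\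
  (forall x, x \e a -> forall y, y \e a -> x \e y \/ x = y \/ y \e x).

Definition limit a : Prop :=
  is_ordinal a /\ ~ (forall z, z \e a -> False) /\
  forall y, y \e a -> exists z, z \e a /\ y \e z.

Definition omega w : Prop := limit w /\ forall z, z \e w -> ~ limit z.

Lemma spec_upair n (e : 'I_n -> V) (z x y : 'I_n) c a b : e z = c -> e x = a -> e y = b ->
  sat e (upair z x y) <-> c = pairset a b.
Proof.
move=> ez ex ey.
suff H : sat e (upair z x y) <-> a \e c /\ b \e c /\ forall t, t \e c -> t = a \/ t = b.
  rewrite H; split=> [[ac [bc h]]|->].
    apply: mem_ext => t; rewrite pairsetP; split=> [/h //|[->|->] //].
  by rewrite !pairsetP; split; [left|split; [right|move=> t /pairsetP]].
by rewrite /upair; spec; rewrite ?sconsE.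
Qed.

Lemma spec_opair n (e : 'I_n -> V) (z x y : 'I_n) c a b : e z = c -> e x = a -> e y = b ->
  sat e (opair z x y) <-> c = opr a b.
Proof.
move=> ez ex ey.
suff H : sat e (opair z x y) <-> exists u, u \e c /\ exists v, v \e c /\
    (u = pairset a a /\ v = pairset a b /\ c = pairset u v).
  rewrite H; split=> [[u [_ [v [_ [-> [-> ->]]]]]]|->] //.
  exists (pairset a a); split; first by apply/pairsetP; left.
  by exists (pairset a b); split; first by apply/pairsetP; right.
rewrite /opair; spec.
- by apply: spec_upair; rewrite !sconsE.
- by apply: spec_upair; rewrite !sconsE.
- by apply: spec_upair; rewrite !sconsE.
Qed.

Lemma spec_has_fst n (e : 'I_n -> V) (x y : 'I_n) a b : e x = a -> e y = b ->
  sat e (has_fst x y) <-> exists v, a = opr b v.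
Proof.
move=> ex ey.
suff H : sat e (has_fst x y) <-> exists u, u \e a /\ exists v, v \e u /\ a = opr b v.
  rewrite H; split=> [[u [_ [v [_ h]]]]|[v h]]; first by exists v.
  exists (pairset b v); rewrite h; split; first by apply/pairsetP; right.
  by exists v; split=> //; apply/pairsetP; right.
by rewrite /has_fst; spec; apply: spec_opair; rewrite ?sconsE.
Qed.

Lemma spec_has_snd n (e : 'I_n -> V) (x y : 'I_n) a b : e x = a -> e y = b ->
  sat e (has_snd x y) <-> exists u, a = opr u b.
Proof.
move=> ex ey.
suff H : sat e (has_snd x y) <-> exists u, u \e a /\ exists v, v \e u /\ a = opr v b.
  rewrite H; split=> [[u [_ [v [_ h]]]]|[v h]]; first by exists v.
  exists (pairset v b); rewrite h; split; first by apply/pairsetP; right.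
  by exists v; split=> //; apply/pairsetP; left.
by rewrite /has_snd; spec; apply: spec_opair; rewrite ?sconsE.
Qed.

Lemma spec_app n (e : 'I_n -> V) (z x y : 'I_n) c a b : e z = c -> e x = a -> e y = b ->
  sat e (app_fm z x y) <-> opr a b \e c.
Proof.
move=> ez ex ey.
suff H : sat e (app_fm z x y) <-> exists p, p \e c /\ p = opr a b.
  by rewrite H; split=> [[p [? <-]]//|h]; exists (opr a b).
by rewrite /app_fm; spec; apply: spec_opair; rewrite ?sconsE.
Qed.

Lemma spec_in_range n (e : 'I_n -> V) (x y : 'I_n) a b : e x = a -> e y = b ->
  sat e (in_range x y) <-> exists u, opr u a \e b.
Proof.
move=> ex ey.
suff H : sat e (in_range x y) <-> exists p, p \e b /\ exists u, p = opr u a.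
  rewrite H; split=> [[p [pb [u up]]]|[u h]]; first by exists u; rewrite -up.
  by exists (opr u a); split=> //; exists u.
by rewrite /in_range; spec; apply: spec_has_snd; rewrite ?sconsE.
Qed.

Lemma spec_subset n (e : 'I_n -> V) (x y : 'I_n) a b : e x = a -> e y = b ->
  sat e (subset_fm x y) <-> subset_in a b.
Proof. by move=> ex ey; rewrite /subset_fm /subset_in; spec. Qed.

Lemma spec_fun_dom n (e : 'I_n -> V) (z x : 'I_n) c a : e z = c -> e x = a ->
  sat e (fun_dom z x) <-> function_on c a.
Proof.
move=> ez ex.
suff H : sat e (fun_dom z x) <->
    (forall p, p \e c -> exists u, u \e a /\ exists v, p = opr u v) /\
    (forall u, u \e a -> exists p, p \e c /\ exists v, p = opr u v) /\
    (forall u, u \e a -> forall p, p \e c -> forall q, q \e c ->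
      (exists v, p = opr u v) -> (exists v, q = opr u v) -> p = q).
  rewrite H; split=> [[h1 [h2 h3]]|[h1 [h2 h3]]].
    split; [move=> p /h1[u [ua [v ->]]]|split=> [u /h2[p [pc [v pv]]]|u v w ua vc wc]].
    - by exists u, v.
    - by exists v; rewrite -pv.
    - have /opr_inj[_ //] := h3 _ ua _ vc _ wc (ex_intro _ v erefl) (ex_intro _ w erefl).
  split=> [p /h1[u [v [ua ->]]]|]; first by exists u; split=> //; exists v.
  split=> [u /h2[v hv]|]; first by exists (opr u v); split=> //; exists v.
  move=> u ua p pc q qc [v pv] [w qw]; rewrite pv qw.
  by congr (opr u _); apply: (h3 u) => //; rewrite -?pv -?qw.
by rewrite /fun_dom; spec; apply: spec_has_fst; rewrite ?sconsE.
Qed.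

Lemma spec_injection n (e : 'I_n -> V) (z x y : 'I_n) c a b : e z = c -> e x = a -> e y = b ->
  sat e (injection_fm z x y) <-> injective_in c a b.
Proof.
move=> ez ex ey.
suff H : sat e (injection_fm z x y) <-> function_on c a /\
   (forall u, u \e a -> exists v, v \e b /\ opr u v \e c) /\
   (forall u, u \e a -> forall u', u' \e a -> forall v, v \e b ->
      opr u v \e c -> opr u' v \e c -> u = u').
  rewrite H; split=> [[h1 [h2 h3]]|[h1 [h2 h3]]].
    by split=> //; split=> // u u' v *; apply: (h3 _ _ _ _ v).
  by split=> //; split=> // u ? u' ? v *; apply: (h3 u u' v).
rewrite /injection_fm; spec; first exact: spec_fun_dom.
all: by apply: spec_app; rewrite ?sconsE.
Qed.

Lemma spec_bijection n (e : 'I_n -> V) (z x y : 'I_n) c a b : e z = c -> e x = a -> e y = b ->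
  sat e (bijection_fm z x y) <->
  injective_in c a b /\ forall v, v \e b -> exists u, opr u v \e c.
Proof.
move=> ez ex ey; rewrite /bijection_fm; spec; first exact: spec_injection.
by apply: spec_in_range; rewrite ?sconsE.
Qed.

Lemma spec_ordinal n (e : 'I_n -> V) (x : 'I_n) a : e x = a ->
  sat e (ordinal_fm x) <-> is_ordinal a.
Proof.
move=> ex; rewrite /ordinal_fm; spec.
by apply: spec_subset; rewrite ?sconsE.
Qed.

Lemma spec_limit n (e : 'I_n -> V) (x : 'I_n) a : e x = a ->
  sat e (limit_fm x) <-> limit a.
Proof.
move=> ex; rewrite /limit_fm /is_empty; spec.
exact: spec_ordinal.
Qed.

Lemma spec_omega n (e : 'I_n -> V) (x : 'I_n) a : e x = a ->
  sat e (is_omega x) <-> omega a.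
Proof.
move=> ex; rewrite /is_omega; spec; first exact: spec_limit.
by apply: spec_limit; rewrite ?sconsE.
Qed.

Lemma choice_function F :
  (forall x, x \e F -> exists y, y \e x) ->
  exists c, function_on c F /\ forall x, x \e F -> exists y, y \e x /\ opr x y \e c.
Proof.
move=> HF; suff H : forall F, (forall y, y \e F -> ~ forall x, x \e y -> False) ->
  exists c, function_on c F /\ forall x, x \e F -> exists y, y \e x /\ opr x y \e c.
  by apply: H => y /HF[x xy] /(_ x xy).
apply: (spec_holds (HV ZFC_choice e0)); rewrite /ax_choice /is_empty; spec.
  by apply: spec_fun_dom; rewrite ?sconsE.
by apply: spec_app; rewrite ?sconsE.
Qed.

(** * Foundation and ordinals *)

Lemma mem_irrefl a : ~ a \e a.
Proof.
move=> aa; have [|y [/pairsetP ya h]] := @foundation (pairset a a).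
  by exists a; apply/pairsetP; left.
have {ya} ya : y = a by case: ya.
by apply: (h a); [apply/pairsetP; left|rewrite ya].
Qed.

Lemma mem_asym a b : a \e b -> ~ b \e a.
Proof.
move=> ab ba; have [|y [/pairsetP ya h]] := @foundation (pairset a b).
  by exists a; apply/pairsetP; left.
case: ya => ?; subst y.
  by apply: (h b) => //; apply/pairsetP; right.
by apply: (h a) => //; apply/pairsetP; left.
Qed.

Lemma minimal a (Q : V -> Prop) : definable (fun g : 'I_1 -> V => Q (g ord0)) ->
  (exists x, x \e a /\ Q x) ->
  exists x, [/\ x \e a, Q x & forall y, y \e x -> y \e a -> ~ Q y].
Proof.
move=> /(sepP a) H [x xaQ].
have [|y [/H[ya Qy] h]] := @foundation (sep a Q); first by exists x; apply/H.
by exists y; split=> // z zy za Qz; apply: (h z) => //; apply/H.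
Qed.

(** Foundation is applied to the set of [a], [b], [c], obtained as a union. The absence of such
    cycles is what makes an element of an ordinal transitive. *)
Lemma mem_no_3cycle a b c : a \e b -> b \e c -> ~ c \e a.
Proof.
move=> ab bc ca; have [|y [/UnionP[s [hs ys]] h]] :=
  @foundation (Union (pairset (pairset a b) (pairset c c))).
  exists a; apply/UnionP; exists (pairset a b).
  by split; apply/pairsetP; left.
have m t : t = a \/ t = b \/ t = c -> t \e Union (pairset (pairset a b) (pairset c c)).
  move=> [->|[->|->]]; apply/UnionP.
  - by exists (pairset a b); split; apply/pairsetP; left.
  - by exists (pairset a b); split; apply/pairsetP; [left|right].
  - by exists (pairset c c); split; apply/pairsetP; [right|left].
have [ya|[yb|yc]] : y = a \/ y = b \/ y = c.
- by move/pairsetP: hs ys => [->|->] /pairsetP; tauto.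
- by apply: (h c); [apply: m; tauto|rewrite ya].
- by apply: (h a); [apply: m; tauto|rewrite yb].
- by apply: (h b); [apply: m; tauto|rewrite yc].
Qed.

Lemma ordinal_trans a x y : is_ordinal a -> x \e a -> y \e x -> y \e a.
Proof. by move=> [tr _] xa; apply: tr. Qed.

Lemma ordinal_mem a x : is_ordinal a -> x \e a -> is_ordinal x.
Proof.
move=> oa xa; have [tr li] := oa.
split=> [y yx z zy|y yx z zx]; last by apply: li; apply: (tr x).
have ya := tr x xa y yx; have za := tr y ya z zy.
case: (li x xa z za) => [xz|[E|//]]; first by case: (mem_no_3cycle zy yx xz).
by subst z; case: (mem_asym yx).
Qed.

(** If [c] is not all of [a], it equals the least element of [a] outside [c]. Applied to the
    intersection of two ordinals this gives trichotomy. *)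
Lemma transitive_subset_ordinal a c : is_ordinal a -> subset_in c a ->
  (forall x, x \e c -> subset_in x c) -> c = a \/ c \e a.
Proof.
move=> [tr li] ca trc; case: (pselect (exists x, x \e a /\ ~ x \e c)) => [h|h]; last first.
  left; apply: mem_ext => z; split=> [/ca //|za].
  by apply: contrapT => zc; apply: h; exists z.
right; have [|m [ma mc hm]] := @minimal a (fun x => ~ x \e c) _ h; first by sdef.
suff -> : c = m by [].
apply: mem_ext => z; split=> [zc|zm].
  case: (li z (ca _ zc) m ma) => [//|[E|mz]]; first by subst z.
  by case: mc; apply: (trc z).
by apply: contrapT => zc; apply: (hm z) => //; apply: (tr m).
Qed.

Lemma ordinal_trichotomy a b : is_ordinal a -> is_ordinal b -> a \e b \/ a = b \/ b \e a.
Proof.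
move=> oa ob; have [tra lia] := oa; have [trb lib] := ob.
pose c := sep a (fun z => z \e b).
have cP z : z \e c <-> z \e a /\ z \e b by apply: sepP; sdef.
have trc x : x \e c -> subset_in x c.
  by move=> /cP[xa xb] z zx; apply/cP; split; [apply: (tra x)|apply: (trb x)].
have [] : c = a \/ c \e a by apply: transitive_subset_ordinal => // z /cP[].
  have [] : c = b \/ c \e b by apply: transitive_subset_ordinal => // z /cP[].
    by move=> -> ->; right; left.
  by move=> + <-; left.
have [] : c = b \/ c \e b by apply: transitive_subset_ordinal => // z /cP[].
  by move=> ->; right; right.
by move=> cb ca; case: (@mem_irrefl c); apply/cP.
Qed.

Lemma ordinal_suc a : is_ordinal a -> is_ordinal (suc a).
Proof.
move=> oa; have [tr li] := oa; split=> [x /sucP[xa|->] z zx|x /sucP[xa|->] y /sucP[ya|->]].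
- by apply/sucP; left; apply: (tr x).
- by apply/sucP; left.
- exact: li.
- by left.
- by right; right.
- by right; left.
Qed.

(** * The set omega and induction on it *)

Definition natural n : Prop := [/\ is_ordinal n, ~ limit n & forall m, m \e n -> ~ limit m].

Lemma empty_or_suc n : is_ordinal n -> ~ limit n ->
  (forall x, ~ x \e n) \/ exists k, k \e n /\ n = suc k.
Proof.
move=> om nlim; case: (pselect (exists x, x \e n)) => [[x xn]|/forallNP]; last by left.
right; have [k kn hk] : exists2 k, k \e n & forall j, j \e n -> ~ k \e j.
  apply: contrapT => h; apply: nlim; split=> //; split; first by move=> /(_ x xn).
  move=> y yn; apply: contrapT => h'; apply: h; exists y => // j jn yj.
  by apply: h'; exists j.
exists k; split=> //; apply: mem_ext => j; rewrite sucP; split=> [jn|[jk|->] //].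
  by have [_ /(_ k kn j jn)] := om => -[/(hk _ jn)|[->|]]; tauto.
exact: ordinal_trans om kn jk.
Qed.

Lemma suc_not_limit n : ~ limit (suc n).
Proof.
move=> [_ [_ h]]; have [z [/sucP[zn|->] nz]] := h n (iffRL (sucP n n) (or_intror erefl)).
  exact: mem_asym nz.
exact: mem_irrefl nz.
Qed.

Lemma omega_exists : exists w, omega w.
Proof.
have [I [[z [zI hz]] IS]] : exists I, (exists z, z \e I /\ forall x, x \e z -> False) /\
    forall y, y \e I -> exists s, s \e I /\ forall x, x \e s <-> x \e y \/ x = y.
  by apply: (spec_holds (HV ZFC_infinity e0)); rewrite /ax_infinity /is_empty; spec.
have IP n : natural n -> n \e I.
  move=> [on nl nl']; apply: contrapT => nI.
  (* The search takes place in [suc n] so that [n] itself is among the candidates. *)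
  have [||x [xn xI hx]] := @minimal (suc n) (fun x => ~ x \e I); first by sdef.
    by exists n; split=> //; apply/sucP; right.
  have [ox xl] : is_ordinal x /\ ~ limit x.
    by move/sucP: xn => [xn|-> //]; split; [exact: ordinal_mem xn|exact: nl'].
  case: (empty_or_suc ox xl) => [x0|[k [kx E]]].
    by apply: xI; have -> : x = z by apply: mem_ext => t; split=> [/x0|/hz].
  have kI : k \e I.
    by apply: contrapT; apply: hx => //; exact: ordinal_trans (ordinal_suc on) xn kx.
  have [s [sI hs]] := IS k kI; apply: xI; rewrite E.
  by have -> : suc k = s by apply: mem_ext => t; rewrite sucP hs.
pose w := sep I natural.
have wP n : n \e w <-> natural n.
  rewrite sepP; first by split=> [[]//|h]; split=> //; exact: IP.
  apply: (definable_ext (Q := fun g => is_ordinal (g ord0) /\ ~ limit (g ord0) /\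
    forall m, m \e g ord0 -> ~ limit m)).
    by move=> g; split=> [[h1 [h2 h3]]|[h1 h2 h3]].
  by rewrite /limit /is_ordinal /subset_in; sdef.
have wS n : n \e w -> suc n \e w.
  move=> /wP[on nl nl']; apply/wP; split; [exact: ordinal_suc|exact: suc_not_limit|].
  by move=> m /sucP[/nl'|->].
exists w; split; last by move=> n /wP[].
split; last first.
  split; last by move=> n nw; exists (suc n); split; [exact: wS|apply/sucP; right].
  have zw : z \e w.
    apply/wP; split; [split=> x /hz //| |by move=> x /hz].
    by move=> [_ [h _]]; exact: h.
  by move=> /(_ z zw).
split=> [n /wP[on nl nl'] m mn|n /wP[on _ _] m /wP[om _ _]].
  apply/wP; split; [exact: ordinal_mem mn|exact: nl'|].
  by move=> k km; apply: nl'; exact: ordinal_trans on mn km.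
exact: ordinal_trichotomy.
Qed.

Lemma omega_unique w w' : omega w -> omega w' -> w = w'.
Proof.
move=> [lw nw] [lw' nw'].
by case: (ordinal_trichotomy (proj1 lw) (proj1 lw')) => [/nw'|[//|/nw]].
Qed.

Section Omega.
Variable w : V.
Hypothesis Hw : omega w.

Let ow : is_ordinal w. Proof. by case: Hw => -[]. Qed.

Lemma omega_suc a : a \e w -> suc a \e w.
Proof.
move=> aw; have oa := ordinal_mem ow aw.
case: (ordinal_trichotomy (ordinal_suc oa) ow) => [//|[E|]].
  have [[_ [_ hl]] _] := Hw; have [b [+ ab]] := hl a aw.
  rewrite -E => /sucP[ba|ba]; first by case: (mem_asym ab).
  by subst b; case: (mem_irrefl ab).
by move/sucP=> [/mem_asym/(_ aw)//|E]; subst a; case: (mem_irrefl aw).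
Qed.

Lemma omega_zero : exists z, z \e w /\ forall x, ~ x \e z.
Proof.
have [|z [zw hz]] := @foundation w.
  by have [[_ [h _]] _] := Hw; apply: contrapT => /forallNP h'; apply: h => z /h'.
exists z; split=> // x xz; apply: (hz x) => //; exact: ordinal_trans ow zw xz.
Qed.

Lemma omega_ind (Q : V -> Prop) : definable (fun g : 'I_1 -> V => Q (g ord0)) ->
  (forall z, z \e w -> (forall x, ~ x \e z) -> Q z) ->
  (forall n, n \e w -> Q n -> Q (suc n)) ->
  forall n, n \e w -> Q n.
Proof.
move=> DQ Q0 QS n nw; apply: contrapT => nQ.
have [||m [mw nQm hm]] := @minimal w (fun x => ~ Q x); first exact: definable_not.
  by exists n.
have om := ordinal_mem ow mw.
case: (empty_or_suc om (proj2 Hw m mw)) => [h|[k [km mk]]]; first by apply: nQm; apply: Q0.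
have kw : k \e w by apply: ordinal_trans ow mw km.
by apply: nQm; rewrite mk; apply: QS => //; apply: contrapT; apply: hm.
Qed.

Lemma suc_inj a b : suc a = suc b -> a = b.
Proof.
move=> E; have: a \e suc b by rewrite -E sucP; right.
have: b \e suc a by rewrite E sucP; right.
by move=> /sucP[ba|->//] /sucP[ab|//]; case: (mem_asym ab).
Qed.

(** Sending [u] to the least [n] with [H u n] extracts a function from the relation without any
    choice. *)
Lemma injection_of_relation x (H : V -> V -> Prop) :
  definable (fun g : 'I_2 -> V => H (g v0) (g v1)) ->
  (forall u, u \e x -> exists n, n \e w /\ H u n) ->
  (forall u u' n, u \e x -> u' \e x -> n \e w -> H u n -> H u' n -> u = u') ->
  exists g, injective_in g x w.
Proof.
move=> DH Htot Hinj.
pose H' u n := H u n /\ forall m, m \e n -> ~ H u m.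
have DH' k (s t : ('I_k -> V) -> V) :
    definable_term s -> definable_term t -> definable (fun g => H' (s g) (t g)).
  move=> Ds Dt; apply: (@definable_comp2 _ _ H') => //; rewrite /H'.
  apply: definable_and => //; sdef.
  by apply: (definable_comp2 DH); sdef.
have H'uniq u n m : n \e w -> m \e w -> H' u n -> H' u m -> n = m.
  move=> nw mw [hn1 hn2] [hm1 hm2]; have [_ li] := ow.
  by case: (li n nw m mw) => [/hm2 //|[//|/hn2 //]].
pose g := sep (cartesian x w) (fun p => exists u n, p = opr u n /\ H' u n).
have gP u n : opr u n \e g <-> u \e x /\ n \e w /\ H' u n.
  rewrite sepP; last by sdef; apply: DH'; sdef.
  rewrite mem_prod; split=> [[[ux nw] [u' [n' [/opr_inj[? ?] h]]]]|[ux [nw h]]].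
    by subst u' n'.
  by split=> //; exists u, n.
have tot u : u \e x -> exists n, n \e w /\ H' u n.
  move=> /Htot h; have [|n [nw hn hm]] := @minimal w (H u) _ h.
    by apply: (definable_comp2 DH); sdef.
  exists n; split=> //; split=> // m mn; apply: hm => //; exact: ordinal_trans ow nw mn.
exists g; split; last split.
- split; last split.
  + move=> p; rewrite sepP; last by sdef; apply: DH'; sdef.
    by move=> [/prodP[u [n [-> [ux nw]]]] _]; exists u, n.
  + by move=> u ux; have [n [nw h]] := tot u ux; exists n; apply/gP.
  + move=> u n m ux /gP[_ [nw hn]] /gP[_ [mw hm]]; exact: H'uniq hn hm.
- by move=> u ux; have [n [nw h]] := tot u ux; exists n; split=> //; apply/gP.
- move=> u u' n ux u'x nw /gP[_ [_ [h1 _]]] /gP[_ [_ [h2 _]]]; exact: Hinj h1 h2.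
Qed.

Lemma injective_comp x y g1 g2 :
  injective_in g1 x y -> injective_in g2 y w -> exists g, injective_in g x w.
Proof.
move=> [_ [t1 i1]] [_ [t2 i2]].
apply: (@injection_of_relation x (fun u n => exists v, v \e y /\ opr u v \e g1 /\ opr v n \e g2)).
- by sdef.
- move=> u /t1[v [vy uv]]; have [n [nw vn]] := t2 v vy.
  by exists n; split=> //; exists v.
- move=> u u' n ux u'x nw [v [vy [uv vn]]] [v' [v'y [uv' vn']]].
  by have ? := i2 _ _ _ vy v'y nw vn vn'; subst v'; apply: i1 uv uv'.
Qed.

End Omega.
(** * Coding by reals *)

(** A substitute for recursion on omega. [K] consists of the members of [B] lying in every set
    closed under [Base] and [Step]; induction holds because the members of [K] satisfying [Q] form
    such a closed set. *)
Lemma inductive_set B (Base : V -> Prop) (Step : V -> V -> Prop) :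
  definable (fun g : 'I_1 -> V => Base (g ord0)) ->
  definable (fun g : 'I_2 -> V => Step (g v0) (g v1)) ->
  (forall p, Base p -> p \e B) -> (forall p q, p \e B -> Step p q -> q \e B) ->
  exists K, [/\ subset_in K B, forall p, Base p -> p \e K,
    forall p q, p \e K -> Step p q -> q \e K &
    forall Q : V -> Prop, definable (fun g : 'I_1 -> V => Q (g ord0)) ->
      (forall p, Base p -> Q p) -> (forall p q, p \e K -> Q p -> Step p q -> Q q) ->
      forall p, p \e K -> Q p].
Proof.
move=> DB DS HB HS.
have DB' k (s : ('I_k -> V) -> V) : definable_term s -> definable (fun g => Base (s g)).
  exact: definable_comp1.
have DS' k (s t : ('I_k -> V) -> V) :
    definable_term s -> definable_term t -> definable (fun g => Step (s g) (t g)).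
  exact: definable_comp2.
pose closed r := (forall p, Base p -> p \e r) /\ (forall p q, p \e r -> Step p q -> q \e r).
have KP := @sepP B (fun p => forall r, closed r -> p \e r) _.
have {}KP z : z \e sep B (fun p => forall r, closed r -> p \e r) <->
    z \e B /\ forall r, closed r -> z \e r.
  by apply: KP; rewrite /closed; sdef; [apply: DB'; sdef|apply: DS'; sdef].
set K := sep _ _ in KP.
have KB : subset_in K B by move=> z /KP[].
have KBase p : Base p -> p \e K.
  by move=> Bp; apply/KP; split=> [|r [hr _]]; [exact: HB|exact: hr].
have KStep p q : p \e K -> Step p q -> q \e K.
  move=> /KP[pB hp] pq; apply/KP; split=> [|r cr]; first exact: HS pq.
  by have [_ hr] := cr; apply: hr pq; exact: hp.
exists K; split=> // Q DQ QB QS p pK.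
have RP := sepP K DQ.
have : p \e sep K Q.
  have [_] := iffLR (KP p) pK; apply; split=> [r Br|r q /RP[rK Qr] rq].
    by apply/RP; split; [exact: KBase|exact: QB].
  by apply/RP; split; [exact: KStep rq|exact: QS rq].
by move/RP=> [].
Qed.

Lemma suc_not_empty a z : (forall x, ~ x \e z) -> suc a <> z.
Proof. by move=> h E; apply: (h a); rewrite -E sucP; right. Qed.

(** * An arithmetical pairing function on omega *)

Section Pairing.
Variable w : V.
Hypothesis Hw : omega w.

(** Coding relies on totality and injectivity, stated with quantifiers bounded by [w] so that the
    notion is Delta_0. *)
Definition pairing K : Prop :=
  (forall n, n \e w -> forall m, m \e w -> exists k, k \e w /\ opr (opr n m) k \e K) /\
  (forall n, n \e w -> forall m, m \e w -> forall n', n' \e w -> forall m', m' \e w ->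
    forall k, k \e w -> opr (opr n m) k \e K -> opr (opr n' m') k \e K -> n = n' /\ m = m').

(* [D] is the graph of [n |-> 2n]. *)
Lemma doubling_exists : exists D,
  [/\ subset_in D (cartesian w w), forall n, n \e w -> exists m, m \e w /\ opr n m \e D,
      forall n n' m, opr n m \e D -> opr n' m \e D -> n = n' &
      forall n n' m m', opr n m \e D -> opr n' m' \e D -> m <> suc m'].
Proof.
have [z [zw hz]] := omega_zero Hw.
have [|||p q|D [DB DBase DStep Dind]] := @inductive_set (cartesian w w) (fun p => p = opr z z)
  (fun p q => exists n m, n \e w /\ m \e w /\ p = opr n m /\ q = opr (suc n) (suc (suc m))).
- by sdef.
- by sdef.
- by move=> p ->; apply/mem_prod.
- move=> pB [n [m [nw [mw [_ ->]]]]]; apply/mem_prod; split; first exact: (omega_suc Hw).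
  by do 2!apply: (omega_suc Hw).
have Dw n m : opr n m \e D -> n \e w /\ m \e w by move=> /DB /mem_prod.
have Dinv p : p \e D -> p = opr z z \/ exists n m, opr n m \e D /\ p = opr (suc n) (suc (suc m)).
  move: p; apply: Dind; first by sdef.
    by move=> q ->; left.
  move=> p1 q p1D _ [n [m [nw [mw [E ->]]]]]; right; exists n, m.
  by rewrite -E.
have Dinv2 n m : opr n m \e D -> (n = z /\ m = z) \/
    exists n' m', [/\ opr n' m' \e D, n = suc n' & m = suc (suc m')].
  move=> /Dinv[/opr_inj[-> ->]|[n' [m' [h /opr_inj[-> ->]]]]]; first by left.
  by right; exists n', m'.
have Sz a : suc a <> z by exact: suc_not_empty.
exists D; split=> //.
- apply: (omega_ind Hw); first by sdef.
    move=> z' z'w hz'; have -> : z' = z.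
      by apply: mem_ext => x; split=> [/hz'|/hz].
    by exists z; split=> //; exact: DBase.
  move=> n nw [m [mw h]]; exists (suc (suc m)).
  split; first by do 2!apply: (omega_suc Hw) => //.
  by apply: DStep h _; exists n, m.
- suff H p : p \e D -> forall n m, p = opr n m -> forall n', opr n' m \e D -> n = n'.
    by move=> n n' m h h'; exact: (H _ h n m).
  move: p; apply: Dind; first by sdef.
    move=> q -> n m /opr_inj[<- <-] n' /Dinv2[[-> _]//|[n1 [m1 [_ _ E]]]].
    by case: (Sz (suc m1)).
  move=> p1 q p1D IH [n [m [nw [mw [E ->]]]]] n1 m1 /opr_inj[<- <-] n' /Dinv2[[_ /Sz]//|].
  move=> [n2 [m2 [h -> /suc_inj /suc_inj E2]]]; subst m2.
  by congr suc; apply: (IH n m).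
(* At a step, the first inequality for [suc (suc m)] reduces to the second one for [m], so the
   induction carries both. *)
- suff H p : p \e D -> forall n m, p = opr n m -> forall n' m', opr n' m' \e D ->
      m <> suc m' /\ m' <> suc m.
    by move=> n n' m m' h h'; have [] := H _ h n m erefl _ _ h'.
  move: p; apply: Dind; first by sdef.
    move=> q -> n m /opr_inj[_ <-] n' m' h'; split; first by move=> E; case: (@Sz m').
    move=> E; case: (Dinv2 _ _ h') => [[_ E']|[n1 [m1 [_ _ E']]]].
      by apply: (@Sz z); rewrite -E.
    by apply: (@Sz m1); apply: suc_inj; rewrite -E' E.
  move=> p1 q p1D IH [n [m [nw [mw [E ->]]]]] n1 m1 /opr_inj[_ <-] n' m' h'.
  split=> [/suc_inj E'|E'].
    by have [_] := IH n m E _ _ h'; rewrite -E'.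
  case: (Dinv2 _ _ h') => [[_ E2]|[n2 [m2 [h2 _ E2]]]].
    by apply: (@Sz (suc (suc m))); rewrite -E' E2.
  have [_] := IH n m E _ _ h2; apply.
  by apply: suc_inj; apply: suc_inj; rewrite -E2 E'.
Qed.

(* [K] is the graph of the injection [(a, b) |-> 2^a (2b + 1)]. *)
Lemma pairing_exists : exists K, pairing K.
Proof.
have [D [DB Dtot Dinj Dpar]] := doubling_exists.
have Dw n m : opr n m \e D -> n \e w /\ m \e w by move=> /DB /mem_prod.
have [z [zw hz]] := omega_zero Hw.
have Sz a : suc a <> z by exact: suc_not_empty.
(* With [z] as 0, the pair [(0, b)] gets the code [2b + 1], and a code [v] of [(a, b)] yields the
   code [2v] of [(a + 1, b)]. Parity separates the two kinds of codes. *)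
have [|||p q|K [KB KBase KStep Kind]] := @inductive_set (cartesian (cartesian w w) w)
  (fun p => exists b m, opr b m \e D /\ p = opr (opr z b) (suc m))
  (fun p q => exists a b v m, p = opr (opr a b) v /\ q = opr (opr (suc a) b) m /\ opr v m \e D).
- by sdef.
- by sdef.
- move=> p [b [m [/Dw[bw mw] ->]]]; apply/mem_prod; split; last exact: (omega_suc Hw).
  exact/mem_prod.
- move=> pB [a [b [v [m [E [-> /Dw[vw mw]]]]]]].
  move: pB; rewrite E => /mem_prod[/mem_prod[aw bw] _].
  by apply/mem_prod; split=> //; apply/mem_prod; split=> //; apply: (omega_suc Hw).
have Kinv p : p \e K -> (exists b m, opr b m \e D /\ p = opr (opr z b) (suc m)) \/
    exists a b v m, opr (opr a b) v \e K /\ p = opr (opr (suc a) b) m /\ opr v m \e D.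
  move: p; apply: Kind; first by sdef.
    by move=> q h; left.
  move=> p1 q p1K _ [a [b [v [m [E [-> h]]]]]]; right; exists a, b, v, m.
  by rewrite -E.
exists K; split.
- move=> a aw b bw; move: a aw; apply: (omega_ind Hw); first by sdef.
    move=> z' z'w hz'; have -> : z' = z.
      by apply: mem_ext => x; split=> [/hz'|/hz].
    have [m [mw h]] := Dtot b bw; exists (suc m); split; first exact: (omega_suc Hw).
    by apply: KBase; exists b, m.
  move=> a aw [k [kw h]]; have [m [mw hm]] := Dtot k kw.
  exists m; split=> //; apply: KStep h _; by exists a, b, k, m.
- suff H p : p \e K -> forall a b k, p = opr (opr a b) k ->
      forall a' b', opr (opr a' b') k \e K -> a = a' /\ b = b'.
    by move=> a _ b _ a' _ b' _ k _ h; apply: (H _ h).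
  move: p; apply: Kind; first by sdef.
    move=> q [b [m [bm ->]]] a1 b1 k1 /opr_inj[/opr_inj[<- <-] <-] a' b' /Kinv.
    move=> [[b2 [m2 [bm2 /opr_inj[/opr_inj[-> ->] /suc_inj E]]]]|].
      by subst m2; split=> //; exact: Dinj bm bm2.
    move=> [a2 [b2 [v [m2 [_ [/opr_inj[_ E] h]]]]]]; subst m2.
    by case: (Dpar _ _ _ _ h bm).
  move=> p1 q p1K IH [a [b [v [m [E [-> vm]]]]]] a1 b1 k1 /opr_inj[/opr_inj[<- <-] <-] a' b' /Kinv.
  move=> [[b2 [m2 [bm2 /opr_inj[_ E2]]]]|].
    by subst m; case: (Dpar _ _ _ _ vm bm2).
  move=> [a2 [b2 [v2 [m2 [h2 [/opr_inj[/opr_inj[-> ->] E2] vm2]]]]]]; subst m2.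
  have ? := Dinj _ _ _ vm vm2; subst v2.
  by have [-> ->] := IH a b v E _ _ h2.
Qed.

End Pairing.

(** * Choosing injections, and families of reals coded by one real *)

Section Enumeration.
Variable w : V.
Hypothesis Hw : omega w.

(* The range [W] is there to bound the quantifiers over injections, which makes *)
(* the notion Delta_0.                                                          *)
Definition enumeration e W x : Prop :=
  (forall a, a \e x -> exists j, j \e W /\ (opr a j \e e /\ injective_in j a w)) /\
  (forall a, a \e x -> forall j, j \e W -> forall j', j' \e W ->
    opr a j \e e -> opr a j' \e e -> j = j').

Lemma injective_in_sub j a x : subset_in a x -> injective_in j a w -> j \e Power (cartesian x w).
Proof.
move=> ax [[j1 [j2 j3]] [j4 _]]; apply/PowerP => p pj.
have [u [v [ua E]]] := j1 p pj; subst p; have [v' [v'w h]] := j4 u ua.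
by rewrite (j3 u v v' ua pj h); apply/mem_prod; split=> //; exact: ax.
Qed.

(** For each [a], the injections of [a] into [w] form a nonempty set. A choice function on the
    family of these sets picks one, and [e] sends [a] to the injection picked from its set. *)
Lemma enumeration_exists x : is_ordinal x ->
  (forall a, a \e x -> exists j, injective_in j a w) -> exists e W, enumeration e W x.
Proof.
move=> [tr _] Hx; pose W := Power (cartesian x w).
pose isX X a := forall j, j \e X <-> j \e W /\ injective_in j a w.
have isX_ex a : a \e x -> exists X, isX X a.
  move=> ax; exists (sep W (fun j => injective_in j a w)) => j; apply: sepP.
  by rewrite /injective_in /function_on; sdef.
have isX_uniq X Y a : isX X a -> isX Y a -> X = Y.
  by move=> h1 h2; apply: mem_ext => z; rewrite (h1 z) (h2 z).
pose F := sep (Power W) (fun X => exists a, a \e x /\ isX X a).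
have FP X : X \e F <-> X \e Power W /\ exists a, a \e x /\ isX X a.
  by apply: sepP; rewrite /isX /injective_in /function_on; sdef.
have [X /FP[_ [a [ax Xa]]]|c [[_ [_ cfun]] cF]] := @choice_function F.
  by have [j h] := Hx a ax; exists j; apply/Xa; split=> //; apply: injective_in_sub h; exact: tr.
pose e := sep (cartesian x W) (fun p => exists a j X,
  p = opr a j /\ X \e F /\ isX X a /\ opr X j \e c).
have eP a j : opr a j \e e <-> [/\ a \e x, j \e W & exists X, [/\ X \e F, isX X a & opr X j \e c]].
  rewrite sepP; last by rewrite /isX /injective_in /function_on; sdef.
  rewrite mem_prod; split.
    move=> [[ax jW] [a' [j' [X [/opr_inj[? ?] [XF [Xa Xj]]]]]]]; subst a' j'.
    by split=> //; exists X.
  by move=> [ax jW [X [XF Xa Xj]]]; split=> //; exists a, j, X.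
exists e, W; split=> [a ax|a ax j jW j' j'W /eP[_ _ [X [XF Xa Xj]]] /eP[_ _ [Y [YF Ya Yj]]]].
  have [X Xa] := isX_ex a ax.
  have XF : X \e F.
    apply/FP; split; last by exists a.
    by apply/PowerP => j /Xa[].
  have [j [jX Xj]] := cF X XF; exists j; have [jW ij] := iffLR (Xa j) jX.
  by split=> //; split=> //; apply/eP; split=> //; exists X.
have ? := isX_uniq _ _ _ Xa Ya; subst Y; exact: cfun Xj Yj.
Qed.

Lemma least_uncountable x : is_ordinal x -> ~ (exists g, injective_in g x w) ->
  exists b, [/\ b \e x \/ b = x, ~ (exists g, injective_in g b w) &
    forall a, a \e b -> exists g, injective_in g a w].
Proof.
move=> ox nx; have osx := ordinal_suc ox.
have [||b [bsx nb hb]] := @minimal (suc x) (fun a => ~ exists g, injective_in g a w).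
- by rewrite /injective_in /function_on; sdef.
- by exists x; split=> //; apply/sucP; right.
exists b; split=> // [|a ab]; first exact/sucP.
by apply: contrapT; apply: hb => //; exact: ordinal_trans osx bsx ab.
Qed.

Variable K : V.
Hypothesis HK : pairing w K.

(* [m] codes a pair of the well-ordering of (part of) [w] copied from [x] by [j]. *)
Definition copied_pair j x m : Prop :=
  exists u v n n', [/\ v \e x, u \e v \/ u = v, n \e w, n' \e w &
    [/\ opr u n \e j, opr v n' \e j & opr (opr n n') m \e K]].

(** Matching points with the same image in [w] gives an isomorphism of the two ordinals, which must
    be the identity; equality follows by using the lemma in both directions. The copied order is
    reflexive so that every point occurs in some code. *)
Lemma copied_pair_subset x x' j j' : is_ordinal x -> is_ordinal x' ->
  injective_in j x w -> injective_in j' x' w ->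
  (forall m, m \e w -> (copied_pair j x m <-> copied_pair j' x' m)) -> subset_in x x'.
Proof.
have [Ktot Kinj] := HK.
pose matched j j' u u' := exists n, n \e w /\ opr u n \e j /\ opr u' n \e j'.
have match_total x1 x2 j1 j2 : injective_in j1 x1 w ->
    (forall m, m \e w -> copied_pair j1 x1 m -> copied_pair j2 x2 m) ->
    forall u, u \e x1 -> exists u', u' \e x2 /\ matched j1 j2 u u'.
  move=> [_ [t1 _]] H u ux; have [n [nw un]] := t1 u ux.
  have [m [mw hm]] := Ktot n nw n nw.
  have [|u1 [v1 [n1 [n1' [v1x _ n1w n1'w [_ v1n hm1]]]]]] := H m mw.
    by exists u, u, n, n; split=> //; right.
  have [_ ?] := Kinj _ nw _ nw _ n1w _ n1'w _ mw hm hm1; subst n1'.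
  by exists v1; split=> //; exists n.
have match_le x1 x2 j1 j2 : is_ordinal x2 -> injective_in j2 x2 w ->
    (forall m, m \e w -> copied_pair j1 x1 m -> copied_pair j2 x2 m) ->
    forall u v u' v', v \e x1 -> u \e v \/ u = v -> u' \e x2 -> v' \e x2 ->
      matched j1 j2 u u' -> matched j1 j2 v v' -> u' \e v' \/ u' = v'.
  move=> o2 [_ [_ i2]] H u v u' v' vx uv u'x v'x [n [nw [un u'n]]] [n' [n'w [vn v'n]]].
  have [m [mw hm]] := Ktot n nw n' n'w.
  have [|u1 [v1 [n1 [n1' [v1x u1v1 n1w n1'w [u1n v1n hm1]]]]]] := H m mw.
    by exists u, v, n, n'; split.
  have [? ?] := Kinj _ nw _ n'w _ n1w _ n1'w _ mw hm hm1; subst n1 n1'.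
  have u1x : u1 \e x2 by case: u1v1 => [|->//]; exact: ordinal_trans o2 v1x.
  by rewrite (i2 u' u1 n) // (i2 v' v1 n').
move=> o1 o2 I1 I2 H.
have [f1 [t1 i1]] := I1; have [f2 [t2 i2]] := I2.
have H12 m : m \e w -> copied_pair j x m -> copied_pair j' x' m by move=> /H[].
have H21 m : m \e w -> copied_pair j' x' m -> copied_pair j x m by move=> /H[].
have matchC j1 j2 u u' : matched j1 j2 u u' -> matched j2 j1 u' u.
  by move=> [n [nw [h1 h2]]]; exists n.
have match_uniq u u' v' : u \e x -> u' \e x' -> v' \e x' ->
    matched j j' u u' -> matched j j' u v' -> u' = v'.
  move=> ux u'x v'x [n [nw [h1 h2]]] [n' [n'w [h1' h2']]].
  have [_ [_ fu]] := f1; have ? := fu _ _ _ ux h1 h1'; subst n'.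
  exact: i2 h2 h2'.
have match_uniq' u v u' : u \e x -> v \e x -> u' \e x' ->
    matched j j' u u' -> matched j j' v u' -> u = v.
  move=> ux vx u'x [n [nw [h1 h2]]] [n' [n'w [h1' h2']]].
  have [_ [_ fu]] := f2; have ? := fu _ _ _ u'x h2 h2'; subst n'.
  exact: i1 h1 h1'.
(* At a least counterexample [u], matching is the identity on elements of [u]; as it respects the
   order both ways, [u] and [u'] have the same elements. *)
have id_match u : u \e x -> forall u', u' \e x' -> matched j j' u u' -> u = u'.
  move=> ux; apply: contrapT => nid.
  have [||{}u [{}ux {}nid hmin]] := @minimal x
    (fun u => ~ forall u', u' \e x' -> matched j j' u u' -> u = u').
  - by rewrite /matched; sdef.
  - by exists u.
  apply: nid => u' u'x' uu'; apply: mem_ext => y; split=> [yu|yu'].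
    have yx := ordinal_trans o1 ux yu.
    have [y' [y'x' yy']] := match_total _ _ _ _ I1 H12 y yx.
    have ? : y = y' by move: y' y'x' yy'; apply: contrapT; exact: hmin.
    subst y'.
    have [//|E] := match_le _ _ _ _ o2 I2 H12 y u y u' ux (or_introl yu) y'x' u'x' yy' uu'.
    subst u'; have ? := match_uniq' _ _ _ ux yx u'x' uu' yy'; subst u.
    by case: (mem_irrefl yu).
  have yx' := ordinal_trans o2 u'x' yu'.
  have [y0 [y0x /matchC y0y]] := match_total _ _ _ _ I2 H21 y yx'.
  have [y0u|E] := match_le _ _ _ _ o1 I1 H21 y u' y0 u u'x' (or_introl yu') y0x ux
    (matchC _ _ _ _ y0y) (matchC _ _ _ _ uu').
    have -> // : y = y0.
    by symmetry; move: y yx' y0y {yu'}; apply: contrapT; exact: hmin.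
  subst y0; have ? := match_uniq _ _ _ ux yx' u'x' y0y uu'; subst y.
  by case: (mem_irrefl yu').
move=> u ux; have [u' [u'x' uu']] := match_total _ _ _ _ I1 H12 u ux.
by rewrite (id_match u ux u' u'x' uu').
Qed.

(* Through [K], the set [c] is read as a sequence of subsets of [w]; it misses *)
(* some section [{m | (x, m) \in r}], [x \in b].                              *)
Definition uncoded c b r : Prop :=
  exists x, x \e b /\ forall n, n \e w -> exists m, m \e w /\
    ~ (opr x m \e r <-> exists k, k \e c /\ opr (opr n m) k \e K).

(** The section of [r] at [x] codes the order of [x] as copied into [w] by the injection that [e]
    chooses. Distinct [x] have distinct sections, so a [c] coding all of them would inject [b] into
    [w]: send [x] to the least row of [c] equal to its section. *)
Lemma uncoded_exists e W b : is_ordinal b -> ~ (exists g, injective_in g b w) ->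
  enumeration e W b -> exists r, forall c, uncoded c b r.
Proof.
move=> ob nb [e1 e2].
pose R x m := exists j, j \e W /\ opr x j \e e /\ exists u v n n',
  v \e x /\ (u \e v \/ u = v) /\ n \e w /\ n' \e w /\
  opr u n \e j /\ opr v n' \e j /\ opr (opr n n') m \e K.
pose r := sep (cartesian b w) (fun p => exists x m, p = opr x m /\ R x m).
have rP x m : x \e b -> m \e w -> opr x m \e r <-> R x m.
  move=> xb mw; rewrite sepP; last by rewrite /R; sdef.
  rewrite mem_prod; split=> [[_ [x' [m' [/opr_inj[-> ->]]]]]//|h].
  by split=> //; exists x, m.
have RP x j m : x \e b -> j \e W -> opr x j \e e -> R x m <-> copied_pair j x m.
  move=> xb jW xj; split.
    move=> [j' [j'W [xj' [u [v [n [n' [h1 [h2 [h3 [h4 [h5 [h6 h7]]]]]]]]]]]]].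
    have ? := e2 x xb j jW j' j'W xj xj'; subst j'.
    by exists u, v, n, n'.
  move=> [u [v [n [n' [h1 h2 h3 h4 [h5 h6 h7]]]]]]; exists j; split=> //; split=> //.
  by exists u, v, n, n'.
exists r => c; apply: contrapT => nc; apply: nb.
apply: (injection_of_relation Hw (H := fun x n => forall m, m \e w ->
  (opr x m \e r <-> exists k, k \e c /\ opr (opr n m) k \e K))).
- by sdef.
- move=> x xb; apply: contrapT => h; apply: nc; exists x; split=> // n nw.
  apply: contrapT => h'; apply: h; exists n; split=> // m mw.
  by apply: contrapT => h''; apply: h'; exists m.
- move=> x x' n xb x'b nw h h'.
  have [j [jW [xj ij]]] := e1 x xb; have [j' [j'W [xj' ij']]] := e1 x' x'b.
  have E m : m \e w -> (copied_pair j x m <-> copied_pair j' x' m).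
    by move=> mw; rewrite -RP // -(RP x') // -!rP // h // h'.
  have ox := ordinal_mem ob xb; have ox' := ordinal_mem ob x'b.
  apply: mem_ext => z; split.
    exact: (copied_pair_subset ox ox' ij ij').
  by apply: (copied_pair_subset ox' ox ij' ij) => m mw; rewrite E.
Qed.

(** An injection [g] of [b] into [w] makes room for every section: the row of [c] with index [g(x)]
    is the section of [r] at [x]. *)
Lemma coded_exists b g r : injective_in g b w -> exists c, subset_in c w /\ ~ uncoded c b r.
Proof.
move=> [[_ [_ gf]] [gt gi]]; have [Ktot Kinj] := HK.
pose c := sep w (fun k => exists x m n, x \e b /\ m \e w /\ n \e w /\
  opr x m \e r /\ opr x n \e g /\ opr (opr n m) k \e K).
have cP k : k \e c <-> k \e w /\ exists x m n, x \e b /\ m \e w /\ n \e w /\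
    opr x m \e r /\ opr x n \e g /\ opr (opr n m) k \e K by apply: sepP; sdef.
exists c; split=> [k /cP[]//|[x [xb hx]]].
have [n [nw xn]] := gt x xb; have [m [mw]] := hx n nw; apply; split.
  move=> xm; have [k [kw hk]] := Ktot n nw m mw; exists k; split=> //.
  by apply/cP; split=> //; exists x, m, n.
move=> [k [/cP[kw [x' [m' [n' [x'b [m'w [n'w [x'm' [x'n' hk']]]]]]]]] hk]].
have [? ?] := Kinj _ nw _ mw _ n'w _ m'w _ kw hk hk'; subst n' m'.
by rewrite (gi x x' n).
Qed.

End Enumeration.

(** * Delta_0 formulas for the coding notions *)

Definition app2_fm l (K n m k : 'I_l) : form l :=
  bex K (bex v0 (bex v0 (fAnd (opair v2 v0 (sh (sh (sh k))))
    (opair v0 (sh (sh (sh n))) (sh (sh (sh m))))))).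

Definition enumeration_fm l (e W x w : 'I_l) : form l :=
  fAnd
    (ball x (bex (sh W) (fAnd (app_fm (sh (sh e)) v1 v0) (injection_fm v0 v1 (sh (sh w))))))
    (ball x (ball (sh W) (ball (sh (sh W))
      (fImp (app_fm (sh (sh (sh e))) v2 v1)
      (fImp (app_fm (sh (sh (sh e))) v2 v0) (eq_fm v1 v0)))))).

Definition pairing_fm l (w K : 'I_l) : form l :=
  fAnd
    (ball w (ball (sh w) (bex (sh (sh w)) (app2_fm (sh (sh (sh K))) v2 v1 v0))))
    (ball w (ball (sh w) (ball (sh (sh w)) (ball (sh (sh (sh w))) (ball (sh (sh (sh (sh w))))
      (fImp (app2_fm (sh (sh (sh (sh (sh K))))) (sh v3) v3 v0)
      (fImp (app2_fm (sh (sh (sh (sh (sh K))))) v2 v1 v0)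
        (fAnd (eq_fm (sh v3) v2) (eq_fm v3 v1))))))))).

(** A value [c] of [f] belongs to a member of a pair [(u, c)] belonging to [f]; the three outer
    bounded quantifiers reach it in this way, which makes quantification over the range of [f]
    Delta_0. *)
Definition uncoded_fm l (f b r K w : 'I_l) : form l :=
  ball f (ball v0 (ball v0 (fImp (has_snd v2 v0)
    (bex (sh (sh (sh b))) (ball (sh (sh (sh (sh w)))) (bex (sh (sh (sh (sh (sh w)))))
      (fNot (fIff (app_fm (sh (sh (sh (sh (sh (sh r)))))) v2 v0)
        (bex v3 (app2_fm (sh (sh (sh (sh (sh (sh (sh K))))))) v2 v1 v0)))))))))).

Lemma spec_app2 l (e : 'I_l -> V) (x1 x2 x3 x4 : 'I_l) K n m k :
  e x1 = K -> e x2 = n -> e x3 = m -> e x4 = k ->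
  sat e (app2_fm x1 x2 x3 x4) <-> opr (opr n m) k \e K.
Proof.
move=> E1 E2 E3 E4.
suff H : sat e (app2_fm x1 x2 x3 x4) <-> exists t, t \e K /\ exists s, s \e t /\
    exists p, p \e s /\ (t = opr p k /\ p = opr n m).
  rewrite H; split=> [[t [tK [s [_ [p [_ [E ?]]]]]]]|h]; first by subst p t.
  exists (opr (opr n m) k); split=> //; exists (pairset (opr n m) k).
  split; first by apply/pairsetP; right.
  by exists (opr n m); split=> //; apply/pairsetP; left.
by rewrite /app2_fm; spec; apply: spec_opair; rewrite ?sconsE.
Qed.

Lemma spec_enumeration l (e : 'I_l -> V) (x1 x2 x3 x4 : 'I_l) f W x w :
  e x1 = f -> e x2 = W -> e x3 = x -> e x4 = w ->
  sat e (enumeration_fm x1 x2 x3 x4) <-> enumeration w f W x.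
Proof.
move=> E1 E2 E3 E4; rewrite /enumeration_fm /enumeration; spec.
- by apply: spec_app; rewrite ?sconsE.
- by apply: spec_injection; rewrite ?sconsE.
- by apply: spec_app; rewrite ?sconsE.
- by apply: spec_app; rewrite ?sconsE.
Qed.

Lemma spec_pairing l (e : 'I_l -> V) (x1 x2 : 'I_l) w K :
  e x1 = w -> e x2 = K -> sat e (pairing_fm x1 x2) <-> pairing w K.
Proof.
move=> E1 E2; rewrite /pairing_fm /pairing; spec.
all: by apply: spec_app2; rewrite ?sconsE.
Qed.

Lemma spec_uncoded l (e : 'I_l -> V) (x1 x2 x3 x4 x5 : 'I_l) f b r K w :
  e x1 = f -> e x2 = b -> e x3 = r -> e x4 = K -> e x5 = w ->
  sat e (uncoded_fm x1 x2 x3 x4 x5) <->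
  forall c, (exists u, opr u c \e f) -> uncoded w K c b r.
Proof.
move=> E1 E2 E3 E4 E5.
suff H : sat e (uncoded_fm x1 x2 x3 x4 x5) <-> forall p, p \e f -> forall q, q \e p ->
    forall c, c \e q -> (exists u, p = opr u c) -> uncoded w K c b r.
  rewrite H; split=> [h c [u uc]|h p pf q qp c cq [u E]]; last first.
    by apply: h; exists u; rewrite -E.
  apply: (h (opr u c) uc (pairset u c)); last by exists u.
    by apply/pairsetP; right.
  by apply/pairsetP; right.
rewrite /uncoded_fm /uncoded; spec.
- by apply: spec_has_snd; rewrite ?sconsE.
- by apply: spec_app; rewrite ?sconsE.
- by apply: spec_app2; rewrite ?sconsE.
Qed.

End SetTheory.

Lemma Delta0_enumeration l (e W x w : 'I_l) : Delta0 (enumeration_fm e W x w).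
Proof.
constructor; do !constructor.
all: try exact: Delta0_app.
all: try exact: Delta0_opair.
all: by apply: Delta0_injection.
Qed.

Lemma Delta0_pairing l (w K : 'I_l) : Delta0 (pairing_fm w K).
Proof. by do !constructor; exact: Delta0_opair. Qed.

Lemma Delta0_uncoded l (f b r K w : 'I_l) : Delta0 (uncoded_fm f b r K w).
Proof. by do !constructor; exact: Delta0_opair. Qed.

(** * Models in the expanded signature *)

Section Reduct.
Variable A : morley_set.

Definition reduct (M : structure (sig_A A)) : structure sig_in :=
  @Structure sig_in M (carrier_inhabited M)
    (fun _ a => @rel_of (sig_A A) M rMem a) (fun f => match f with end).

Lemma sat_to_A (M : structure (sig_A A)) n (e : 'I_n -> M) (phi : form n) :
  sat e (to_A A phi) <-> sat (M := reduct M) e phi.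
Proof.
have E k (e' : 'I_k -> M) (t : term sig_in k) :
    eval e' (term_to_A A t) = eval (M := reduct M) e' t by case: t => [//|[]].
elim: phi e => //= {n}.
- by move=> n t u e; rewrite !E.
- move=> n r a e; rewrite (_ : (fun j => _) = fun j => eval (M := reduct M) e (a j)) //.
  by apply/funext => j; rewrite E.
- by move=> n p IHp q IHq e; rewrite IHp IHq.
- by move=> n p IHp q IHq e; rewrite IHp IHq.
- by move=> n p IHp q IHq e; rewrite IHp IHq.
- by move=> n p IHp e; split=> h x; apply/IHp/h.
- by move=> n p IHp e; split=> -[x /IHp h]; exists x.
Qed.

Definition memA_in (M : structure (sig_A A)) (x y : M) : Prop :=
  @mem_in (reduct M) x y.

Lemma mem_embedding (M N : structure (sig_A A)) (h : M -> N) : embedding h ->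
  forall x y, memA_in (h x) (h y) <-> memA_in x y.
Proof.
move=> hh x y; rewrite /memA_in /mem_in /=.
rewrite -(embedding_rel hh (r := rMem)).
rewrite (_ : tnth [tuple h x; h y] = fun j => h (tnth [tuple x; y] j)) //.
by apply/funext => j; case: (unliftP ord0 j) => [k|] ->; rewrite ?ord1.
Qed.

Lemma spec_memA (M : structure (sig_A A)) n (e : 'I_n -> M) t u x y :
  eval e t = x -> eval e u = y -> sat e (memA t u) <-> memA_in x y.
Proof.
move=> <- <-; rewrite /memA_in /mem_in /=.
rewrite (_ : tnth [tuple eval e t; eval e u] = fun j => eval e (tnth [tuple t; u] j)) //.
by apply/funext => j; case: (unliftP ord0 j) => [k|] ->; rewrite ?ord1.
Qed.

Section Model.
Variables (R : theory sig_in) (hR : ZFC `<=` R) (hA : in_Delta0 `<=` A).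
Variables (P : structure (sig_A A)) (HP : model_of (R_plus_T R A) P).

Lemma reduct_ZFC : model_of ZFC (reduct P).
Proof.
move=> phi /hR Rphi e; apply/sat_to_A; apply: HP; left; by exists phi.
Qed.

Definition atom_of (M : structure (sig_A A)) k (phi : form k.+1) (d : Delta0 phi)
    (a : 'I_k.+1 -> M) : Prop :=
  @rel_of (sig_A A) M (rPhi (hA (in_Delta0_rel d))) a.

Lemma atom_ofP k (phi : form k.+1) (d : Delta0 phi) (a : 'I_k.+1 -> P) :
  atom_of d a <-> sat (M := reduct P) a phi.
Proof.
have /holds_univ_closure/(_ a) := HP (or_intror (T_Ax0 (hA (in_Delta0_rel d)))).
by rewrite /= sat_to_A => -[h1 h2]; split.
Qed.

Lemma function_symbolP (phi : Form_in) (h : A (phi, true)) (a : 'I_(fi_n phi) -> P) :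
  (exists y, sat (M := reduct P) (scons y a) (fi_phi phi) /\
    forall z, sat (M := reduct P) (scons z a) (fi_phi phi) -> z = y) ->
  sat (M := reduct P) (scons (@fct_of (sig_A A) P (fPhi h) a) a) (fi_phi phi).
Proof.
move=> [y [h1 h2]].
have /holds_univ_closure/(_ a) := HP (or_intror (T_Ax1 h)).
rewrite sat_fAnd sat_fImp => -[H _].
have : sat a (subst (scons (fctA h tVar) tVar) (to_A A (fi_phi phi))).
  apply: H; exists y; split; first exact/sat_to_A.
  move=> z; rewrite sat_fImp sat_rename /= !sconsE => hz; apply: h2.
  apply/sat_to_A; rewrite (_ : scons z a =
    fun i => scons z (scons y a) (scons v0 (fun i => sh (sh i)) i)) //.
  by apply/funext => i; case: (unliftP ord0 i) => [k|] ->; rewrite !sconsE.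
rewrite sat_subst sat_to_A.
rewrite (_ : (fun i => eval a _) = scons (fct_of (s := P) (f := fPhi h) a) a) //.
by apply/funext => i; case: (unliftP ord0 i) => [k|] ->; rewrite !sconsE.
Qed.

End Model.

(** Since every Delta_0 formula with a free variable has its own relation symbol, embeddings
    preserve and reflect these symbols even where the defining axioms fail. *)
Lemma atom_of_embedding (hA : in_Delta0 `<=` A) (M N : structure (sig_A A)) (h : M -> N) :
  embedding h -> forall k (phi : form k.+1) (d : Delta0 phi) (a : 'I_k.+1 -> M),
  atom_of hA d (fun i => h (a i)) <-> atom_of hA d a.
Proof. by move=> hh k phi d a; exact: (embedding_rel hh). Qed.

End Reduct.

(** * The symbols for omega and the Godel operations *)

Section SetTheoryOfModels.
Variables (R : theory sig_in) (A : morley_set).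
Hypotheses (hR : ZFC `<=` R) (hA : in_Delta0 `<=` A).
Local Notation T := (R_plus_T R A).
Implicit Types M N P : structure (sig_A A).

Lemma fun_ord0 (X : Type) (a b : 'I_0 -> X) : a = b.
Proof. by apply/funext => -[]. Qed.

Definition om M : M :=
  @fct_of (sig_A A) M (fPhi (hA in_Delta0_omega))
    (fun _ => inhabited_witness (carrier_inhabited M)).

Lemma eval_omegaA M n (e : 'I_n -> M) : eval e (omegaA hA n) = om M.
Proof. by rewrite /= /om; congr fct_of; exact: fun_ord0. Qed.

Lemma om_embedding M N (h : M -> N) : embedding h -> h (om M) = om N.
Proof. by move=> hh; rewrite /om (embedding_fct hh); congr fct_of; exact: fun_ord0. Qed.

Lemma omP P : model_of T P -> omega (V := reduct P) (om P).
Proof.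
move=> HP; have ZP := reduct_ZFC hR HP.
have S y (a : 'I_0 -> P) : sat (M := reduct P) (scons y a) (is_omega v0) <->
    omega (V := reduct P) y by apply: spec_omega; rewrite scons0.
have [w hw] := omega_exists ZP.
apply/S; apply: (@function_symbolP _ _ _ HP _ (hA in_Delta0_omega)).
exists w; split; first exact/S.
by move=> z /S hz; apply: (omega_unique ZP).
Qed.

Definition god M k (hk : k < size godel_ops) (a : 'I_(fi_n (nth omega_fm godel_ops k)) -> M) : M :=
  @fct_of (sig_A A) M (fPhi (hA (in_Delta0_godel hk))) a.

Definition env2 (X : Type) (x y : X) : 'I_2 -> X := scons x (scons y (fun _ => x)).
Definition env1 (X : Type) (x : X) : 'I_1 -> X := scons x (fun _ => x).

Definition gpair M (x y : M) : M := @god M 0 isT (env2 x y).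
Definition gprod M (x y : M) : M := @god M 1 isT (env2 x y).
Definition gdiff M (x y : M) : M := @god M 3 isT (env2 x y).
Definition gcap M (x y : M) : M := @god M 4 isT (env2 x y).
Definition gcup M (x : M) : M := @god M 5 isT (env1 x).

Section GodelEmbedding.
Variables (M N : structure (sig_A A)) (h : M -> N).
Hypothesis hh : embedding h.

Let god_embedding k (hk : k < size godel_ops) a :
  h (@god M k hk a) = @god N k hk (fun i => h (a i)).
Proof. by rewrite /god (embedding_fct hh). Qed.

Let env2_map x y : (fun i => h (env2 x y i)) = env2 (h x) (h y).
Proof. by rewrite /env2 !comp_scons. Qed.

Let env1_map x : (fun i => h (env1 x i)) = env1 (h x).
Proof. by rewrite /env1 !comp_scons. Qed.

(** Embeddings commute with function symbols, so a Godel operation evaluated in [N] at points coming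
    from [M] has its value in the image of [M]. *)
Lemma gpair_embedding x y : h (gpair x y) = gpair (h x) (h y).
Proof. by rewrite /gpair god_embedding env2_map. Qed.

Lemma gprod_embedding x y : h (gprod x y) = gprod (h x) (h y).
Proof. by rewrite /gprod god_embedding env2_map. Qed.

Lemma gdiff_embedding x y : h (gdiff x y) = gdiff (h x) (h y).
Proof. by rewrite /gdiff god_embedding env2_map. Qed.

Lemma gcap_embedding x y : h (gcap x y) = gcap (h x) (h y).
Proof. by rewrite /gcap god_embedding env2_map. Qed.

Lemma gcup_embedding x : h (gcup x) = gcup (h x).
Proof. by rewrite /gcup god_embedding env1_map. Qed.

End GodelEmbedding.

Section GodelValues.
Variable P : structure (sig_A A).
Hypothesis HP : model_of T P.
Local Notation V := (reduct P).
Let ZP : model_of ZFC V := reduct_ZFC hR HP.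
Local Notation "a \e b" := (@mem_in V a b) (at level 70, no associativity).

Lemma reduct_extensionality (x y : P) : (forall z, z \e x <-> z \e y) -> x = y.
Proof. exact: (mem_ext ZP). Qed.

Let comprehensionP n (psi : form n.+1) (hpsi : A (FormIn (comprehension psi), true))
    (a : 'I_n -> P) (Q : V -> Prop) (b : V) :
  (forall z, sat (M := V) (scons z a) psi <-> Q z) ->
  (forall z, z \e b <-> Q z) ->
  @fct_of (sig_A A) P (fPhi hpsi) a = b.
Proof.
move=> hQ hb.
have S y : sat (M := V) (scons y a) (comprehension psi) <-> forall z, z \e y <-> Q z.
  rewrite /comprehension; apply: spec_all => z; apply: spec_iff.
    by apply: spec_mem; rewrite !sconsE.
  rewrite sat_rename -hQ (_ : (fun i => _) = scons z a) //; apply/funext => i.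
  by case: (unliftP ord0 i) => [k|] ->; rewrite !sconsE.
have H : sat (M := V) (scons (@fct_of (sig_A A) P (fPhi hpsi) a) a) (comprehension psi).
  apply: (@function_symbolP _ _ _ HP _ hpsi); exists b; split; first exact/S.
  by move=> z /S hz; apply: reduct_extensionality => t; rewrite hz hb.
by apply: reduct_extensionality => t; rewrite hb; move: t; apply/S.
Qed.

Lemma gpairE (x y : P) : gpair x y = pairset (V := V) x y.
Proof.
apply: (@comprehensionP 2 _ (hA (@in_Delta0_godel 0 isT)) (env2 x y)
  (fun z => z = x \/ z = y)); last exact: pairsetP.
by move=> z; rewrite /env2; spec.
Qed.

Lemma gprodE (x y : P) : gprod x y = cartesian ZP x y.
Proof.
apply: (@comprehensionP 2 _ (hA (@in_Delta0_godel 1 isT)) (env2 x y)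
  (fun z => exists u, u \e x /\ exists v, v \e y /\ z = opr u v)).
  move=> z; rewrite /env2; spec.
  by apply: (spec_opair ZP); rewrite !sconsE.
move=> z; rewrite prodP //; split=> [[u [v [? []]]]|[u [ux [v []]]]].
  by exists u; split=> //; exists v.
by exists u, v.
Qed.

Lemma mem_gdiff (x y z : P) : z \e gdiff x y <-> z \e x /\ ~ z \e y.
Proof.
pose b := sep (V := V) x (fun z => ~ z \e y).
have bP t : t \e b <-> t \e x /\ ~ t \e y by apply: (sepP ZP); def.
suff -> : gdiff x y = b by [].
apply: (@comprehensionP 2 _ (hA (@in_Delta0_godel 3 isT)) (env2 x y)
  (fun z => z \e x /\ ~ z \e y)) => // t.
by rewrite /env2; spec.
Qed.

Lemma mem_gcap (x y z : P) : z \e gcap x y <-> z \e x /\ z \e y.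
Proof.
pose b := sep (V := V) x (fun z => z \e y).
have bP t : t \e b <-> t \e x /\ t \e y by apply: (sepP ZP); def.
suff -> : gcap x y = b by [].
apply: (@comprehensionP 2 _ (hA (@in_Delta0_godel 4 isT)) (env2 x y)
  (fun z => z \e x /\ z \e y)) => // t.
by rewrite /env2; spec.
Qed.

Lemma gcupE (x : P) : gcup x = Union ZP x.
Proof.
apply: (@comprehensionP 1 _ (hA (@in_Delta0_godel 5 isT)) (env1 x)
  (fun z => exists y, y \e x /\ z \e y)); last exact: UnionP.
by move=> z; rewrite /env1; spec.
Qed.

End GodelValues.

(* The point is [j = U (U (U (e n ({a} x W))) \ {a})], unless [j = a]. *)
Lemma value_in_substructure M P (h : M -> P) (e W a : M) (j : P) :
  model_of T P -> embedding h -> memA_in j (h W) ->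
  mem_in (V := reduct P) (opr (V := reduct P) (h a) j) (h e) ->
  (forall j', memA_in j' (h W) ->
    mem_in (V := reduct P) (opr (V := reduct P) (h a) j') (h e) -> j' = j) ->
  exists t : M, h t = j.
Proof.
move=> HP hh jW aj uniq.
case: (pselect (j = h a)) => [->|ja]; first by exists a.
pose s := gpair a a.
exists (gcup (gdiff (gcup (gcup (gcap e (gprod s W)))) s)).
rewrite gcup_embedding // gdiff_embedding // !gcup_embedding // gcap_embedding //.
rewrite gprod_embedding // gpair_embedding // gpairE // gprodE // !gcupE.
set ZP := reduct_ZFC hR HP; set S := pairset _ _; set X := gcap _ _.
have SP z : mem_in (V := reduct P) z S <-> z = h a by rewrite pairsetP //; tauto.
have XP z : mem_in (V := reduct P) z X <-> z = opr (V := reduct P) (h a) j.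
  rewrite mem_gcap // prodP //; split=> [[ze [u [v [E [/SP ? vW]]]]]|->].
    by subst u z; rewrite (uniq v).
  by split=> //; exists (h a), j; rewrite SP.
have UX : Union ZP X = opr (V := reduct P) (h a) j.
  apply: (reduct_extensionality HP) => z; rewrite UnionP; split=> [[y [/XP ->]]//|hz].
  by exists (opr (V := reduct P) (h a) j); rewrite XP.
rewrite UX.
apply: (reduct_extensionality HP) => z; rewrite UnionP.
have D y : mem_in (V := reduct P) y (gdiff (Union ZP (opr (V := reduct P) (h a) j)) S) <-> y = j.
  rewrite mem_gdiff // SP UnionP; split=> [[[t [/(pairsetP ZP)[->|->]]]]|->].
  - by move=> /(pairsetP ZP)[->|->].
  - by move=> /(pairsetP ZP)[->|->].
  split=> //; exists (pairset (V := reduct P) (h a) j); rewrite !pairsetP //; tauto.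
by split=> [[y [/D ->]]//|hz]; exists j; rewrite D.
Qed.

End SetTheoryOfModels.
(** * The continuum hypothesis across a chain of models *)

Section Chain.
Variables (R : theory sig_in) (A : morley_set).
Hypotheses (hR : ZFC `<=` R) (hA : in_Delta0 `<=` A).
Local Notation T := (R_plus_T R A).

Definition bijective_in (V : structure sig_in) (g x y : V) : Prop :=
  injective_in g x y /\ forall v, mem_in v y -> exists u, mem_in (opr u v) g.

(** * Reading the formulas of a substructure in a model of ZFC *)

Section Interpretation.
Variables (M P : structure (sig_A A)) (h : M -> P).
Hypotheses (hh : embedding h) (HP : model_of T P).
Local Notation V := (reduct P).
Let ZP : model_of ZFC V := reduct_ZFC hR HP.

(** [M] need not satisfy the axiom defining the symbol, but [h] preserves and reflects the symbol,
    and in [P] it means [phi]. *)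
Lemma sat_atom n (e : 'I_n -> M) k (phi : form k.+1) (d : Delta0 phi) a :
  sat e (atom hA d a) <-> sat (M := V) (fun j => h (eval e (tnth a j))) phi.
Proof.
by rewrite -(atom_ofP hA HP d) (atom_of_embedding hA hh).
Qed.

Lemma spec_subsetA n (e : 'I_n -> M) t u x y : eval e t = x -> eval e u = y ->
  sat e (subsetA hA t u) <-> subset_in (V := V) (h x) (h y).
Proof. by move=> E1 E2; rewrite /subsetA sat_atom; apply: spec_subset; rewrite -?E1 -?E2. Qed.

Lemma spec_ordinalA n (e : 'I_n -> M) t x : eval e t = x ->
  sat e (ordinalA hA t) <-> is_ordinal (V := V) (h x).
Proof. by move=> E1; rewrite /ordinalA sat_atom; apply: spec_ordinal; rewrite -?E1. Qed.

Lemma spec_fun_domA n (e : 'I_n -> M) t u x y : eval e t = x -> eval e u = y ->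
  sat e (fun_domA hA t u) <-> function_on (V := V) (h x) (h y).
Proof.
by move=> E1 E2; rewrite /fun_domA sat_atom; apply: (spec_fun_dom ZP); rewrite -?E1 -?E2.
Qed.

Lemma spec_in_rangeA n (e : 'I_n -> M) t u x y : eval e t = x -> eval e u = y ->
  sat e (in_rangeA hA t u) <-> exists v : V, mem_in (opr v (h x : V)) (h y).
Proof.
by move=> E1 E2; rewrite /in_rangeA sat_atom; apply: (spec_in_range ZP); rewrite -?E1 -?E2.
Qed.

Lemma spec_injectionA n (e : 'I_n -> M) s t u z x y :
  eval e s = z -> eval e t = x -> eval e u = y ->
  sat e (injectionA hA s t u) <-> injective_in (V := V) (h z) (h x) (h y).
Proof.
move=> E1 E2 E3; rewrite /injectionA sat_atom.
by apply: (spec_injection ZP); rewrite -?E1 -?E2 -?E3.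
Qed.

Lemma spec_bijectionA n (e : 'I_n -> M) s t u z x y :
  eval e s = z -> eval e t = x -> eval e u = y ->
  sat e (bijectionA hA s t u) <-> bijective_in (V := V) (h z) (h x) (h y).
Proof.
move=> E1 E2 E3; rewrite /bijectionA sat_atom.
by apply: (spec_bijection ZP); rewrite -?E1 -?E2 -?E3.
Qed.

Definition enumerationA n (s t u v : term (sig_A A) n) : formula (sig_A A) n :=
  atom hA (Delta0_enumeration (v0 : 'I_4) v1 v2 v3) [tuple s; t; u; v].

Lemma spec_enumerationA n (e : 'I_n -> M) s t u v f W x w :
  eval e s = f -> eval e t = W -> eval e u = x -> eval e v = w ->
  sat e (enumerationA s t u v) <-> enumeration (V := V) (h w) (h f) (h W) (h x).
Proof.
move=> E1 E2 E3 E4; rewrite /enumerationA sat_atom.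
by apply: (spec_enumeration ZP); rewrite -?E1 -?E2 -?E3 -?E4.
Qed.

Definition pairingA n (s t : term (sig_A A) n) : formula (sig_A A) n :=
  atom hA (Delta0_pairing (v0 : 'I_2) v1) [tuple s; t].

Lemma spec_pairingA n (e : 'I_n -> M) s t w K : eval e s = w -> eval e t = K ->
  sat e (pairingA s t) <-> pairing (V := V) (h w) (h K).
Proof.
by move=> E1 E2; rewrite /pairingA sat_atom; apply: (spec_pairing ZP); rewrite -?E1 -?E2.
Qed.

Definition uncodedA n (t1 t2 t3 t4 t5 : term (sig_A A) n) : formula (sig_A A) n :=
  atom hA (Delta0_uncoded (v0 : 'I_5) v1 v2 v3 (sh v3)) [tuple t1; t2; t3; t4; t5].

Lemma spec_uncodedA n (e : 'I_n -> M) t1 t2 t3 t4 t5 f b r K w :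
  eval e t1 = f -> eval e t2 = b -> eval e t3 = r -> eval e t4 = K -> eval e t5 = w ->
  sat e (uncodedA t1 t2 t3 t4 t5) <-> forall c : V,
    (exists u : V, mem_in (opr u c) (h f)) -> uncoded (V := V) (h w) (h K) c (h b) (h r).
Proof.
move=> E1 E2 E3 E4 E5; rewrite /uncodedA sat_atom.
by apply: (spec_uncoded ZP); rewrite -?E1 -?E2 -?E3 -?E4 -?E5.
Qed.

(* What the formulas of [CH] say in [M], in terms of the model [P] of ZFC: only *)
(* unbounded quantifiers are relativized to [M], where ZFC may fail.           *)
Definition countable_in (x : M) : Prop := exists g : M, injective_in (V := V) (h g) (h x) (om hA P).

Definition cardinal_in (x : M) : Prop := is_ordinal (V := V) (h x) /\
  forall y : M, memA_in y x -> ~ exists g : M, bijective_in (V := V) (h g) (h x) (h y).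

Definition first_uncountable_in (x : M) : Prop :=
  cardinal_in x /\ (~ countable_in x /\
  forall y : M, memA_in y x -> cardinal_in y -> countable_in y).

Definition covers_reals (f : M) : Prop := forall r : M, subset_in (V := V) (h r) (om hA P) ->
  exists v : V, mem_in (opr v (h r : V)) (h f).

Lemma spec_countableA n (e : 'I_n -> M) x a : e x = a ->
  sat e (countableA hA x) <-> countable_in a.
Proof.
move=> E; rewrite /countableA /countable_in -(om_embedding hA hh); apply: spec_ex => g.
by apply: spec_injectionA; rewrite ?eval_omegaA //= sconsE.
Qed.

Lemma spec_cardinalA n (e : 'I_n -> M) x a : e x = a ->
  sat e (cardinalA hA x) <-> cardinal_in a.
Proof.
move=> E; rewrite /cardinalA; apply: spec_and; first exact: spec_ordinalA.
apply: spec_all => y; apply: spec_imp; first by apply: spec_memA; rewrite /= ?sconsE.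
apply: spec_not; apply: spec_ex => g.
by apply: spec_bijectionA; rewrite /= ?sconsE.
Qed.

Lemma spec_first_uncountable n (e : 'I_n -> M) x a : e x = a ->
  sat e (first_uncountable_cardinal hA x) <-> first_uncountable_in a.
Proof.
move=> E; rewrite /first_uncountable_cardinal; apply: spec_and; first exact: spec_cardinalA.
apply: spec_and; first by apply: spec_not; exact: spec_countableA.
apply: spec_all => y; apply: spec_imp; first by apply: spec_memA; rewrite /= ?sconsE.
apply: spec_imp; first by apply: spec_cardinalA; rewrite sconsE.
by apply: spec_countableA; rewrite sconsE.
Qed.

(** Separated from the existential quantifier so that one and the same [f] can be followed through
    elementary maps. *)
Lemma spec_enumerates_body n (e : 'I_n.+1 -> M) x f a : e v0 = f -> e (sh x) = a ->
  sat e (fAnd (fun_domA hA (tVar v0) (tVar (sh x)))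
    (fAll (fImp (subsetA hA (tVar v0) (omegaA hA _)) (in_rangeA hA (tVar v0) (tVar v1))))) <->
  function_on (V := V) (h f) (h a) /\ covers_reals f.
Proof.
move=> E1 E2; apply: spec_and; first exact: spec_fun_domA.
rewrite /covers_reals -(om_embedding hA hh).
apply: spec_all => r; apply: spec_imp.
  by apply: spec_subsetA; rewrite ?eval_omegaA //= sconsE.
by apply: spec_in_rangeA; rewrite /= ?sconsE.
Qed.

Lemma spec_enumerates n (e : 'I_n -> M) x a : e x = a ->
  sat e (enumerates_reals hA x) <-> exists f, function_on (V := V) (h f) (h a) /\ covers_reals f.
Proof.
move=> E; rewrite /enumerates_reals; apply: spec_ex => f.
by apply: spec_enumerates_body; rewrite ?sconsE.
Qed.

End Interpretation.

Lemma embedding_id (L : signature) (M : structure L) : embedding (fun x : M => x).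
Proof. by split. Qed.

(** * Absoluteness between models of [T] *)

Section Transfer.
Variables (P P' : structure (sig_A A)) (k : P -> P').
Hypotheses (kk : embedding k) (HP : model_of T P) (HP' : model_of T P').
Let id_emb := embedding_id P.

Let e5 (x y z t u : P) : 'I_5 -> P :=
  scons x (scons y (scons z (scons t (scons u (fun _ : 'I_0 => x))))).

(** The same atom is read in [P] through the identity and in [P'] through [k]. The other transfer
    lemmas repeat the argument. *)
Lemma transfer_injective g x y : injective_in (V := reduct P) g x y <->
  injective_in (V := reduct P') (k g) (k x) (k y).
Proof.
rewrite -(spec_injectionA kk HP' (e := e5 g x y x x) (s := tVar v0) (t := tVar v1)
  (u := tVar v2)) ?/e5 /= ?sconsE //.
by symmetry; apply: (spec_injectionA id_emb HP); rewrite /= ?sconsE.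
Qed.

Lemma transfer_bijective g x y : bijective_in (V := reduct P) g x y <->
  bijective_in (V := reduct P') (k g) (k x) (k y).
Proof.
rewrite -(spec_bijectionA kk HP' (e := e5 g x y x x) (s := tVar v0) (t := tVar v1)
  (u := tVar v2)) ?/e5 /= ?sconsE //.
by symmetry; apply: (spec_bijectionA id_emb HP); rewrite /= ?sconsE.
Qed.

Lemma transfer_ordinal x : is_ordinal (V := reduct P) x <-> is_ordinal (V := reduct P') (k x).
Proof.
rewrite -(spec_ordinalA kk HP' (e := e5 x x x x x) (t := tVar v0)) ?/e5 /= ?sconsE //.
by symmetry; apply: (spec_ordinalA id_emb HP); rewrite /= ?sconsE.
Qed.

Lemma transfer_subset x y : subset_in (V := reduct P) x y <->
  subset_in (V := reduct P') (k x) (k y).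
Proof.
rewrite -(spec_subsetA kk HP' (e := e5 x y x x x) (t := tVar v0) (u := tVar v1))
  ?/e5 /= ?sconsE //.
by symmetry; apply: (spec_subsetA id_emb HP); rewrite /= ?sconsE.
Qed.

Lemma transfer_in_range x y :
  (exists v : reduct P, mem_in (opr v (x : reduct P)) y) <->
  (exists v : reduct P', mem_in (opr v (k x : reduct P')) (k y)).
Proof.
rewrite -(spec_in_rangeA kk HP' (e := e5 x y x x x) (t := tVar v0) (u := tVar v1))
  ?/e5 /= ?sconsE //.
by symmetry; apply: (spec_in_rangeA id_emb HP); rewrite /= ?sconsE.
Qed.

Lemma transfer_enumeration w f W x : enumeration (V := reduct P) w f W x <->
  enumeration (V := reduct P') (k w) (k f) (k W) (k x).
Proof.
rewrite -(spec_enumerationA kk HP' (e := e5 w f W x x) (s := tVar v1) (t := tVar v2)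
  (u := tVar v3) (v := tVar v0)) ?/e5 /= ?sconsE //.
by symmetry; apply: (spec_enumerationA id_emb HP); rewrite /= ?sconsE.
Qed.

Lemma transfer_pairing w K : pairing (V := reduct P) w K <->
  pairing (V := reduct P') (k w) (k K).
Proof.
rewrite -(spec_pairingA kk HP' (e := e5 w K w w w) (s := tVar v0) (t := tVar v1))
  ?/e5 /= ?sconsE //.
by symmetry; apply: (spec_pairingA id_emb HP); rewrite /= ?sconsE.
Qed.

Lemma transfer_uncoded f b r K w :
  (forall c : reduct P, (exists u : reduct P, mem_in (opr u c) f) ->
    uncoded (V := reduct P) w K c b r) <->
  (forall c : reduct P', (exists u : reduct P', mem_in (opr u c) (k f)) ->
    uncoded (V := reduct P') (k w) (k K) c (k b) (k r)).
Proof.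
rewrite -(spec_uncodedA kk HP' (e := e5 f b r K w) (t1 := tVar v0) (t2 := tVar v1)
  (t3 := tVar v2) (t4 := tVar v3) (t5 := tVar (sh v3))) ?/e5 /= ?sconsE //.
by symmetry; apply: (spec_uncodedA id_emb HP); rewrite /= ?sconsE.
Qed.

(* The reals [r_x], [x \in b], are distinct; a collapse of [b] would code all of *)
(* them into one real, whereas no real in the range of [f] does so, and that is *)
(* a Delta_0 fact about [f].                                                    *)
Lemma uncountable_preserved f b :
  is_ordinal (V := reduct P) b ->
  ~ (exists g, injective_in (V := reduct P) g b (om hA P)) ->
  (forall a, memA_in a b -> exists g, injective_in (V := reduct P) g a (om hA P)) ->
  (forall c, subset_in (V := reduct P') c (om hA P') ->
    exists u : reduct P', mem_in (opr u (c : reduct P')) (k f)) ->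
  ~ (exists g, injective_in (V := reduct P') g (k b) (om hA P')).
Proof.
move=> ob nb cb cov [g ig].
have ZP := reduct_ZFC hR HP; have ZP' := reduct_ZFC hR HP'.
have W := omP hR hA HP; have W' := omP hR hA HP'.
have [K HK] := pairing_exists ZP W.
have [e [X HeX]] := enumeration_exists ZP ob cb.
have [r Hr] := uncoded_exists ZP W HK ob nb HeX.
have kw := om_embedding hA kk.
have HK' : pairing (V := reduct P') (om hA P') (k K) by rewrite -kw -transfer_pairing.
have := iffLR (transfer_uncoded f b r K (om hA P)) (fun c _ => Hr c).
rewrite kw => Hr'.
have [c [cw nc]] := coded_exists ZP' HK' (k r) ig.
by apply: nc; apply: Hr'; exact: cov.
Qed.

End Transfer.

(** * The cardinal given by CH is the least uncountable ordinal of [P] *)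

Section Collapse.
Variables (P N1 P1 N2 P2 : structure (sig_A A)).
Variables (k1 : P -> N1) (k2 : N1 -> P1) (k3 : P1 -> N2) (k4 : N2 -> P2).
Hypotheses (kk1 : embedding k1) (kk2 : embedding k2) (kk3 : embedding k3) (kk4 : embedding k4).
Hypotheses (HP : model_of T P) (HP1 : model_of T P1) (HP2 : model_of T P2).
Variables (x f : P).
Hypotheses (x_unc1 : first_uncountable_in (P := P1) k2 (k1 x))
  (f_cov1 : covers_reals (P := P1) k2 (k1 f))
  (f_cov2 : covers_reals (P := P2) k4 (k3 (k2 (k1 f)))).

Let k21 := embedding_comp kk1 kk2.
Let k43 := embedding_comp kk3 kk4.

Lemma not_countable_down : ~ exists g, injective_in (V := reduct P) g x (om hA P).
Proof.
move=> [g /(transfer_injective k21 HP HP1) ig].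
have [_ [h _]] := x_unc1; apply: h; exists (k1 g).
by rewrite (om_embedding hA k21) in ig.
Qed.

(** A real of [P] is a value of [f] in [P1], and being in the range of [f] is Delta_0. *)
Lemma covers_reals_down : covers_reals (P := P) (fun y : P => y) f.
Proof.
move=> r hr; apply/(transfer_in_range k21 HP HP1); apply: f_cov1.
by rewrite -(om_embedding hA k21); apply/(transfer_subset k21 HP HP1).
Qed.

(** [f_cov1] speaks only of the reals of [N1]; that [f] covers all reals of [P1] comes from [N2],
    which contains them. *)
Lemma covers_reals_down1 : forall c, subset_in (V := reduct P1) c (om hA P1) ->
  exists u : reduct P1, mem_in (opr u (c : reduct P1)) (k2 (k1 f)).
Proof.
move=> c hc; apply/(transfer_in_range k43 HP1 HP2); apply: f_cov2.
by rewrite -(om_embedding hA k43); apply/(transfer_subset k43 HP1 HP2).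
Qed.

(** Let [b] be the least uncountable ordinal of [P]; it has an enumeration there and remains
    uncountable in [P1]. If [b] were an element of [x], it would be a cardinal of [N1] below the
    first uncountable one, hence countable in [N1]. So [b] is [x]. *)
Lemma enumeration_of_first_uncountable :
  exists e W, enumeration (V := reduct P) (om hA P) e W x.
Proof.
have ZP := reduct_ZFC hR HP; have ZP1 := reduct_ZFC hR HP1.
have W := omP hR hA HP; have W1 := omP hR hA HP1.
have ox : is_ordinal (V := reduct P) x.
  by apply/(transfer_ordinal k21 HP HP1); have [[]] := x_unc1.
have [b [bx nb cb]] := least_uncountable ZP ox not_countable_down.
have ob : is_ordinal (V := reduct P) b by case: bx => [bx|-> //]; exact: ordinal_mem bx.
have nb1 := uncountable_preserved k21 HP HP1 ob nb cb covers_reals_down1.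
have [e [X heX]] := enumeration_exists ZP ob cb.
case: bx => [bx|E]; last by exists e, X; rewrite -E.
have bx1 : memA_in (k1 b) (k1 x) by apply/(mem_embedding kk1).
case: nb1; have [_ [_ /(_ _ bx1)]] := x_unc1; case.
  split; first by apply/(transfer_ordinal k21 HP HP1).
  (* Here [y] may be an element of [b] new in [N1], about which [cb] says nothing; the enumeration,
     transferred to [P1], still supplies an injection of it into omega. *)
  move=> y yb [g [ig _]].
  have [e1 _] := iffLR (transfer_enumeration k21 HP HP1 _ _ _ _) heX.
  have [j [_ [_ ij]]] := e1 (k2 y) (iffRL (mem_embedding kk2 y (k1 b)) yb).
  apply: (uncountable_preserved k21 HP HP1 ob nb cb covers_reals_down1).
  apply: (injective_comp ZP1 W1 ig).
  by rewrite -(om_embedding hA k21); exact: ij.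
by move=> g ig; exists (k2 g).
Qed.

End Collapse.

(** Existential over a Delta_0 atom, so that it passes from [P] up to [N1]; elementarity then
    applies to it. *)
Definition enumerated n (x : 'I_n) : formula (sig_A A) n :=
  fEx (fEx (enumerationA (tVar v1) (tVar v0) (tVar (sh (sh x))) (omegaA hA _))).

Lemma spec_enumerated (M P : structure (sig_A A)) (h : M -> P) : embedding h -> model_of T P ->
  forall n (e : 'I_n -> M) x a, e x = a -> sat e (enumerated x) <->
    exists f W, enumeration (V := reduct P) (om hA P) (h f) (h W) (h a).
Proof.
move=> hh HP n e x a E; rewrite -(om_embedding hA hh).
apply: spec_ex => f; apply: spec_ex => W.
by apply: (spec_enumerationA hh HP); rewrite ?eval_omegaA //= !sconsE.
Qed.

End Chain.

Theorem theorem7p5 (R : theory sig_in) (A : morley_set)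
    (hR : ZFC `<=` R)
    (hAMC : in_AMC_spectrum R A)
    (hA : in_Delta0 `<=` A)
    (hcons : consistent
       ([set not_CH hA] `|` forall_or_exists_part (R_plus_T R A))) :
  ~ AMC R A (CH hA).
Proof.
move=> [S [mcS ST] SCH]; have [M0 HM0] := hcons.
set T := R_plus_T R A.
have HM0T : model_of (forall_or_exists_part T) M0 by move=> p Tp; apply: HM0; right.
have HM0S : model_of (forall_or_exists_part S) M0 by rewrite ST.
(* [M0] itself need not contain a model of [S]; it is replaced by a model [M] of the same theory
   that does. *)
have [N0 [M [h0 [SN0 HM hh0]]]] := model_embedded_in_theory HM0S HM0.
have MT : model_of (forall_or_exists_part T) M by move=> p Tp; apply: HM; right.
have toS (P : structure (sig_A A)) : model_of T P ->
    exists (N : structure (sig_A A)) (h : P -> N), model_of S N /\ embedding h.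
  move=> TP; apply: embeds_in_model_of_universal_part; rewrite ST.
  exact: model_forall_or_exists_part.
have toT (N : structure (sig_A A)) : model_of S N ->
    exists (P : structure (sig_A A)) (h : N -> P), model_of T P /\ embedding h.
  move=> SN; apply: embeds_in_model_of_universal_part; rewrite -ST.
  exact: model_forall_or_exists_part.
have [P [h1 [TP hh1]]] := embeds_in_model_of_universal_part MT.
have [N1 [k1 [SN1 kk1]]] := toS P TP.
have [P1 [k2 [TP1 kk2]]] := toT N1 SN1.
have [N2 [k3 [SN2 kk3]]] := toS P1 TP1.
have [P2 [k4 [TP2 kk4]]] := toT N2 SN2.
have h10 := embedding_comp hh0 hh1.
have el1 := mcS _ _ _ SN0 SN1 (embedding_comp h10 kk1).
have el2 := mcS _ _ _ SN1 SN2 (embedding_comp kk2 kk3).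
pose e0 : 'I_0 -> N0 := fun _ => inhabited_witness (carrier_inhabited N0).
have := SCH N0 SN0 e0.
rewrite /CH sat_fEx => -[x0]; rewrite sat_fAnd => -[x0_unc].
rewrite /enumerates_reals sat_fEx => -[f0 f0_enum].
pose x := h1 (h0 x0); pose f := h1 (h0 f0).
have x_unc1 : first_uncountable_in hA (P := P1) k2 (k1 x).
  move/el1: x0_unc; apply: (iffLR (spec_first_uncountable hR hA kk2 TP1 _)).
  by rewrite scons0.
have /el1 f1_enum := f0_enum.
have [_ f_cov1] : function_on (V := reduct P1) (k2 (k1 f)) (k2 (k1 x)) /\
    covers_reals hA (P := P1) k2 (k1 f).
  by apply: (iffLR (spec_enumerates_body hR hA kk2 TP1 _ _) f1_enum); rewrite !sconsE.
move/el2: f1_enum => f2_enum.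
have [_ f_cov2] : function_on (V := reduct P2) (k4 (k3 (k2 (k1 f)))) (k4 (k3 (k2 (k1 x)))) /\
    covers_reals hA (P := P2) k4 (k3 (k2 (k1 f))).
  by apply: (iffLR (spec_enumerates_body hR hA kk4 TP2 _ _) f2_enum); rewrite !sconsE.
(* The enumeration found in [P] is seen in [N1], and elementarity of [N0] in [N1] yields witnesses
   already in [N0], hence in [M]. *)
have [e [W heW]] : exists e W : N0, enumeration (V := reduct P) (om hA P) (h1 (h0 e)) (h1 (h0 W)) x.
  pose e1 := scons x0 e0.
  apply/(spec_enumerated hR hA h10 TP (e := e1) (x := v0)); first by rewrite /e1 scons0.
  apply/el1; apply/(spec_enumerated hR hA kk2 TP1 (a := k1 x)).
    by rewrite /e1 scons0.
  have [e [W heW]] := enumeration_of_first_uncountable hR kk1 kk2 kk3 kk4 TP TP1 TP2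
    x_unc1 f_cov2.
  exists (k1 e), (k1 W).
  rewrite -(om_embedding hA (embedding_comp kk1 kk2)).
  exact/(transfer_enumeration hR hA (embedding_comp kk1 kk2) TP TP1).
have x_unc : ~ exists g, injective_in (V := reduct P) g x (om hA P).
  exact: (not_countable_down hR kk1 kk2 TP TP1 x_unc1).
have f_cov : covers_reals hA (P := P) (fun y : P => y) f.
  exact: (covers_reals_down hR kk1 kk2 TP TP1 f_cov1).
have kk21 := embedding_comp kk1 kk2.
have ZP := reduct_ZFC hR TP.
have := HM _ (or_introl erefl) (fun _ => inhabited_witness (carrier_inhabited M)).
rewrite /not_CH sat_fEx => -[y]; rewrite sat_fAnd.
move=> [/(spec_first_uncountable hR hA hh1 TP (scons0 _ _)) [[oy y_card] [y_unc y_first]] y_enum].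
have x_card : cardinal_in (P := P1) k2 (k1 x) by have [] := x_unc1.
have ox : is_ordinal (V := reduct P) x.
  by apply/(transfer_ordinal hA kk21 TP TP1); have [] := x_card.
(* A bijection in [M] of [x] onto one of its elements would also be one in [N1], where [x] is a
   cardinal. *)
have x_cardM : cardinal_in (P := P) h1 (h0 x0).
  split=> // z zx [g bg]; have [_ /(_ (k1 (h1 z)))] := x_card; apply.
    by apply/(mem_embedding kk1); apply/(mem_embedding hh1).
  by exists (k1 (h1 g)); apply/(transfer_bijective hR hA kk21 TP TP1).
case: (ordinal_trichotomy ZP oy ox) => [yx|[E|xy]].
(* The injection that [e] assigns to [y] is obtained from [e], [W] and [y] by Godel operations, so
   it lies in [M] and makes [y] countable there. *)
- have [he hu] := heW; have [j [jW [yj ij]]] := he _ yx.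
  have [t ht] := value_in_substructure hR hA TP hh1 jW yj
    (fun j' j'W yj' => hu _ yx _ j'W _ jW yj' yj).
  by apply: y_unc; exists t; rewrite ht.
- have {}E : y = h0 x0 by exact: (embedding_inj hh1).
  apply: y_enum; apply/(spec_enumerates hR hA hh1 TP (scons0 _ _)).
  (* Reals of [M] are reals of [P], and [f] covers those. *)
  exists (h0 f0); split; last by move=> r hr; exact: f_cov.
  have [isf _] : function_on (V := reduct P) f x /\ covers_reals hA (P := P) (h1 \o h0) f0.
    by apply: (iffLR (spec_enumerates_body hR hA h10 TP _ _) f0_enum); rewrite !sconsE.
  by rewrite E.
(* Being a cardinal of [M] below [y], [x] would be countable in [M], hence in [P]. *)
- have xyM : memA_in (h0 x0) y by apply/(mem_embedding hh1).
  by have [g ig] := y_first _ xyM x_cardM; apply: x_unc; exists (h1 g).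
Qed.
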